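(* Let $q$ be an odd prime power, let $S\subseteq \mathbb P^1$ be a finite set of $\mathbb F_q$-rational places containing $B=\{0,\infty\}$, and let $S_0=S\setminus B$. (1) The group $\Gamma_S$ has the following presentation: it is generated by $\bigcup_{\tau\in S_0} PA_\tau$, subject to the following relations: (i) for all $\tau\in S_0$ and $[1+\alpha F]\in PA_\tau$: $[1+\alpha F]\cdot[1-\alpha F]=1$; (ii) for all $\tau\neq\sigma$ in $S_0$, $[1+\alpha F]\in PA_\tau$ and $[1+\beta F]\in PA_\sigma$: $$[1+\alpha F]\cdot[1+\beta F]=[1+\zeta_\alpha(\beta)\beta F]\cdot[1+\zeta_\beta(\alpha)\alpha F].$$ (2) The group $\Gamma_S$ acts on the cube complex $\mathbf T_{S_0}$ without fixing a cell (no non-trivial element maps a cell to itself). In particular, $\Gamma_S$ is torsion-free.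
   Context: Let $K=\mathbb F_q(t)$ be the function field of $\mathbb P^1$ over $\mathbb F_q$, $q$ odd. Fix a non-square $c\in\mathbb F_q$ and let $D=K\{Z,F\}/(Z^2=c,\ F^2=t,\ FZ=-ZF)$, a quaternion algebra over $K$ ramified exactly at the places $B=\{0,\infty\}$ (i.e. $t=0$, $t=\infty$). The subring $\mathbb F_q[Z]=\mathbb F_q\oplus\mathbb F_qZ\subseteq D$ is a field with $q^2$ elements; $\alpha\mapsto\bar\alpha$ denotes its non-trivial $\mathbb F_q$-automorphism, and $N(\alpha)=\alpha\bar\alpha$ its norm to $\mathbb F_q$; one has $F\alpha=\bar\alpha F$. For a finite set of places $S\supseteq B$ put $S_0=S\setminus B$, let $\mathfrak o_{K,S}$ be the ring of $S$-integers (functions regular outside $S$), $\mathcal A(\mathfrak o_{K,S})=\mathfrak o_{K,S}\oplus\mathfrak o_{K,S}Z\oplus\mathfrak o_{K,S}F\oplus\mathfrak o_{K,S}FZ\subseteq D$, and $\Lambda_S=\mathcal A(\mathfrak o_{K,S})^\times/\mathfrak o_{K,S}^\times$. Write $[w]\in\Lambda_S$ for the class of $w\in\mathcal A(\mathfrak o_{K,S})^\times$. A rational place other than $0,\infty$ is given by some $\tau\in\mathbb F_q^\times$ (the place $t=\tau$). Put $PA_\tau=\{[1+\alpha F]:\alpha\in\mathbb F_q[Z],\ N(\alpha)=\tau^{-1}\}$ (a subset of $\Lambda_{\{0,\tau,\infty\}}\subseteq \Lambda_S$ if $\tau\in S_0$; the map $1+\alpha F\mapsto[1+\alpha F]$ is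 injective on these elements). For $S$ consisting of rational places, $\Gamma_S\subseteq\Lambda_S$ is the subgroup generated by all $PA_\tau$, $\tau\in S_0$. For $\alpha,\beta\in\mathbb F_q[Z]^\times$ with $N(\alpha)\ne N(\beta)$ put $\zeta_\alpha(\beta)=\dfrac{1+\alpha/\beta}{1+\bar\alpha/\bar\beta}$, an element of norm $1$. For $v\in S_0$ let $K_v$ be the completion at $v$ and $\mathcal T_v$ the Bruhat–Tits tree of $(D\otimes_KK_v)^\times/K_v^\times\simeq \mathrm{PGL}_2(K_v)$, a $(q+1)$-regular tree for rational $v$. The product $\mathbf T_{S_0}=\prod_{v\in S_0}\mathcal T_v$ is a cube complex with the product cell structure, on which $\Lambda_S$ acts via $\Lambda_S\hookrightarrow\prod_{v\in S_0}\mathrm{PGL}_2(K_v)$. *)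

(* Defs.v *)
From HB Require Import structures.
From mathcomp Require Import all_boot all_order all_algebra generic_quotient.
From mathcomp Require Import boolp classical_sets.
From mathcomp Require Import ring.

Set Implicit Arguments.
Unset Strict Implicit.
Unset Printing Implicit Defensive.

Import Order.TTheory GRing.Theory Num.Theory.
Local Open Scope classical_set_scope.
Local Open Scope quotient_scope.
Local Open Scope ring_scope.

(* [quat a b] is R{Z,F}/(Z^2 = a, F^2 = b, FZ = -ZF), in coordinates with      *)
(* respect to the basis 1, Z, F, FZ (in this order).                           *)
Record quat (R : comNzRingType) (a b : R) := Quat { q1 : R; qz : R; qf : R; qfz : R }.
Arguments Quat {R a b}.

Section QuatRing.
Variables (R : comNzRingType) (a b : R).
Local Notation D := (quat a b).
Implicit Types x y : D.

Definition quat_tuple x := (q1 x, qz x, qf x, qfz x).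
Definition tuple_quat (p : R * R * R * R) : D := let: (x, y, z, w) := p in Quat x y z w.
Lemma quat_tupleK : cancel quat_tuple tuple_quat. Proof. by case. Qed.
HB.instance Definition _ := Choice.copy D (can_type quat_tupleK).

Definition qadd x y : D := Quat (q1 x + q1 y) (qz x + qz y) (qf x + qf y) (qfz x + qfz y).
Definition qopp x : D := Quat (- q1 x) (- qz x) (- qf x) (- qfz x).
Definition qscale r x : D := Quat (r * q1 x) (r * qz x) (r * qf x) (r * qfz x).
Definition qmul x y : D := Quat
  (q1 x * q1 y + a * (qz x * qz y) + b * (qf x * qf y) - a * b * (qfz x * qfz y))
  (q1 x * qz y + qz x * q1 y + b * (qf x * qfz y) - b * (qfz x * qf y))
  (q1 x * qf y + qf x * q1 y - a * (qz x * qfz y) + a * (qfz x * qz y))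
  (q1 x * qfz y + qfz x * q1 y - qz x * qf y + qf x * qz y).

Ltac quat_ring := repeat case=> ? ? ? ?; congr Quat => /=; ring.

Lemma qaddA : associative qadd. Proof. quat_ring. Qed.
Lemma qaddC : commutative qadd. Proof. quat_ring. Qed.
Lemma qadd0 : left_id (Quat 0 0 0 0) qadd. Proof. quat_ring. Qed.
Lemma qaddN : left_inverse (Quat 0 0 0 0) qopp qadd. Proof. quat_ring. Qed.
HB.instance Definition _ := GRing.isZmodule.Build D qaddA qaddC qadd0 qaddN.

Lemma qmulA : associative qmul. Proof. quat_ring. Qed.
Lemma qmul1l : left_id (Quat 1 0 0 0) qmul. Proof. quat_ring. Qed.
Lemma qmul1r : right_id (Quat 1 0 0 0) qmul. Proof. quat_ring. Qed.
Lemma qmulDl : left_distributive qmul qadd. Proof. quat_ring. Qed.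
Lemma qmulDr : right_distributive qmul qadd. Proof. quat_ring. Qed.
Lemma quat1_neq0 : Quat 1 0 0 0 != 0 :> D.
Proof. by apply/eqP; case; apply/eqP/oner_neq0. Qed.
HB.instance Definition _ := GRing.Zmodule_isNzRing.Build D
  qmulA qmul1l qmul1r qmulDl qmulDr quat1_neq0.

Lemma qscaleA r s x : qscale r (qscale s x) = qscale (r * s) x.
Proof. by case: x => *; congr Quat => /=; ring. Qed.
Lemma qscale1 : left_id 1 qscale. Proof. quat_ring. Qed.
Lemma qscaleDr : right_distributive qscale +%R. Proof. move=> r; quat_ring. Qed.
Lemma qscaleDl x : {morph qscale^~ x : r s / r + s}.
Proof. by move=> r s; case: x => *; congr Quat => /=; ring. Qed.
HB.instance Definition _ := GRing.Zmodule_isLmodule.Build R D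
  qscaleA qscale1 qscaleDr qscaleDl.

Lemma qscaleAl (r : R) x y : r *: (x * y) = (r *: x) * y.
Proof. by case: x y => ? ? ? ? [? ? ? ?]; congr Quat => /=; ring. Qed.
HB.instance Definition _ := GRing.Lmodule_isLalgebra.Build R D qscaleAl.
Lemma qscaleAr (r : R) x y : r *: (x * y) = x * (r *: y).
Proof. by case: x y => ? ? ? ? [? ? ? ?]; congr Quat => /=; ring. Qed.
HB.instance Definition _ := GRing.Lalgebra_isAlgebra.Build R D qscaleAr.

Definition qZ : D := Quat 0 1 0 0.
Definition qF : D := Quat 0 0 1 0.

Lemma qZ_sq : qZ ^+ 2 = a%:A. Proof. by congr Quat => /=; ring. Qed.
Lemma qF_sq : qF ^+ 2 = b%:A. Proof. by congr Quat => /=; ring. Qed.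
Lemma qFZ : qF * qZ = - (qZ * qF). Proof. by congr Quat => /=; ring. Qed.
Lemma quatE x : x = (q1 x)%:A + qz x *: qZ + qf x *: qF + qfz x *: (qF * qZ).
Proof. by case: x => *; congr Quat => /=; ring. Qed.

Definition qconj x : D := Quat (q1 x) (- qz x) (- qf x) (- qfz x).
Definition nrd x : R :=
  q1 x ^+ 2 - a * qz x ^+ 2 - b * qf x ^+ 2 + a * b * qfz x ^+ 2.

Lemma qmulJ x : x * qconj x = (nrd x)%:A.
Proof. by case: x => *; rewrite /nrd; congr Quat => /=; ring. Qed.
Lemma qmulJl x : qconj x * x = (nrd x)%:A.
Proof. by case: x => *; rewrite /nrd; congr Quat => /=; ring. Qed.
Lemma nrdM x y : nrd (x * y) = nrd x * nrd y.
Proof. by case: x y => ? ? ? ? [? ? ? ?]; rewrite /nrd /=; ring. Qed.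
Lemma nrd1 : nrd 1 = 1. Proof. by rewrite /nrd /=; ring. Qed.
End QuatRing.

Section QuatUnit.
Variables (K : fieldType) (a b : K).
Local Notation D := (quat a b).
Implicit Types x y : D.

Definition qunit : pred D := fun x => nrd x != 0.
Definition qinv x : D := if qunit x then (nrd x)^-1 *: qconj x else x.

Lemma qmulV : {in qunit, left_inverse 1 qinv *%R}.
Proof.
move=> x; rewrite unfold_in => ux.
by rewrite /qinv (ux : qunit x) -scalerAl qmulJl scalerA mulVf // scale1r.
Qed.
Lemma qdivq : {in qunit, right_inverse 1 qinv *%R}.
Proof.
move=> x; rewrite unfold_in => ux.
by rewrite /qinv (ux : qunit x) -scalerAr qmulJ scalerA mulVf // scale1r.
Qed.
Lemma qunitP x y : y * x = 1 /\ x * y = 1 -> qunit x.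
Proof.
case=> _ /(congr1 (@nrd _ _ _)); rewrite nrdM nrd1 => h.
by apply/eqP => x0; move: h; rewrite x0 mul0r => /esym/eqP; rewrite oner_eq0.
Qed.
Lemma qinv_out : {in [predC qunit], qinv =1 id}.
Proof. by move=> x nx; rewrite /qinv ifN. Qed.
HB.instance Definition _ := GRing.NzRing_hasMulInverse.Build D
  qmulV qdivq qunitP qinv_out.
End QuatUnit.

Section QuatMap.
Variables (R R' : comNzRingType) (a b : R) (f : R -> R').
(* For a field extension f this is the map D -> D (x)_R R'. *)
Definition qmap (x : quat a b) : quat (f a) (f b) :=
  Quat (f (q1 x)) (f (qz x)) (f (qf x)) (f (qfz x)).
End QuatMap.

(* A field of fractions of F[t].  The constructions below are made for an      *)
(* abstract one, as [{fraction {poly F}}] makes unification very slow.          *)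
Record ratfun (F : finFieldType) := RatFun {
  rffield :> fieldType;
  fr : {rmorphism {poly F} -> rffield};
  fr_inj : injective fr;
  fr_frac : forall f : rffield, exists n d : {poly F}, d != 0 /\ f = fr n / fr d }.

Lemma tofrac_inj (R : idomainType) : injective (@FracField.tofrac R).
Proof. by move=> p q /eqP; rewrite tofrac_eq => /eqP. Qed.
Lemma tofrac_frac (R : idomainType) (f : {fraction R}) :
  exists n d : R, d != 0 /\ f = FracField.tofrac n / FracField.tofrac d.
Proof.
elim/quotW: f => x; have d0 := denom_ratioP x.
exists (frac x).1, (frac x).2; split; first by [].
have fd0 : FracField.tofrac (frac x).2 != 0 :> {fraction R} by rewrite tofrac_eq0.
apply: (canRL (mulfK fd0)).
rewrite -[LHS]/(FracField.mul _ _) !piE; apply/eqmodP.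
rewrite /= FracField.equivfE /FracField.mulf.
by rewrite !numden_Ratio ?mulf_neq0 ?oner_neq0 ?mulr1 // mulrC.
Qed.

(* F_q(t) *)
Definition Fqt (F : finFieldType) : ratfun F :=
  RatFun (@tofrac_inj {poly F}) (@tofrac_frac {poly F}).

Section FunctionField.
Variables (F : finFieldType) (K : ratfun F).
Local Notation fr := (fr K).

Definition cst (x : F) : K := fr x%:P.
Definition tK : K := fr 'X.

(* Finite sets S of rational places containing 0 and oo; a point of            *)
(* P^1(F_q) = F_q u {oo} is an [option F], with oo = None.                     *)
Record rplaces := RPlaces {
  rplace :> {set option F};
  _ : (Some 0 \in rplace) && (None \in rplace) }.

(* S_0 = S \ {0, oo} *)
Definition finplaces (S : rplaces) : {set F} :=
  [set x | (x != 0) && (Some x \in rplace S)].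

Definition regular_at (P : {poly F}) (f : K) :=
  exists n d : {poly F}, ~~ (P %| d) /\ f = fr n / fr d.

(* The finite places are the monic irreducible polynomials, t = x corresponding *)
(* to 'X - x; there is no condition at oo because oo lies in S.                 *)
Definition Sint (S : rplaces) (f : K) : Prop :=
  forall P : {poly F}, P \is monic -> irreducible_poly P ->
    (forall x, Some x \in rplace S -> P <> 'X - x%:P) -> regular_at P f.

Definition Sunit S (f : K) : Prop := [/\ f != 0, Sint S f & Sint S f^-1].

Variable S : rplaces.

Lemma Sint_fr p : Sint S (fr p).
Proof.
move=> P _ irrP _; exists p, 1; split; last by rewrite rmorph1 divr1.
by rewrite dvdp1; case: irrP; case: ltngtP.
Qed.

Lemma fr_neq0 P d : ~~ (P %| d) -> fr d != 0.
Proof. by move=> h; rewrite -(rmorph0 fr) (inj_eq (@fr_inj _ K)); apply: contra h => /eqP ->; apply: dvdp0. Qed.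

Lemma irr_dvdM (P d e : {poly F}) : irreducible_poly P ->
  ~~ (P %| d) -> ~~ (P %| e) -> ~~ (P %| d * e).
Proof.
move=> irrP hd; rewrite Gauss_dvdpr //; rewrite /coprimep.
have [_ /(_ (gcdp P d))] := irrP => h.
case: eqP => // /eqP /h /(_ (dvdp_gcdl _ _)) e1.
by move: hd; rewrite -(eqp_dvdl _ e1) dvdp_gcdr.
Qed.

Lemma SintD f g : Sint S f -> Sint S g -> Sint S (f + g).
Proof.
move=> hf hg P mP irrP nP.
have [n [d [nd ->]]] := hf P mP irrP nP; have [m [e [ne ->]]] := hg P mP irrP nP.
exists (n * e + m * d), (d * e); split; first exact: irr_dvdM.
by rewrite (addf_div _ _ (fr_neq0 nd) (fr_neq0 ne)) rmorphD !rmorphM.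
Qed.

Lemma SintM f g : Sint S f -> Sint S g -> Sint S (f * g).
Proof.
move=> hf hg P mP irrP nP.
have [n [d [nd ->]]] := hf P mP irrP nP; have [m [e [ne ->]]] := hg P mP irrP nP.
exists (n * m), (d * e); split; first exact: irr_dvdM.
by rewrite mulf_div !rmorphM.
Qed.

Lemma SintN f : Sint S f -> Sint S (- f).
Proof.
by move=> hf; rewrite -mulN1r -(rmorph1 fr) -rmorphN; apply: SintM => //; apply: Sint_fr.
Qed.

Lemma SintB f g : Sint S f -> Sint S g -> Sint S (f - g).
Proof. by move=> hf hg; apply/SintD/SintN. Qed.

Lemma Sint0 : Sint S 0. Proof. by rewrite -(rmorph0 fr); apply: Sint_fr. Qed.
Lemma Sint1 : Sint S 1. Proof. by rewrite -(rmorph1 fr); apply: Sint_fr. Qed.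

Lemma Sunit1 : Sunit S 1.
Proof. by split; rewrite ?invr1 ?oner_neq0 //; apply: Sint1. Qed.
Lemma SunitM f g : Sunit S f -> Sunit S g -> Sunit S (f * g).
Proof.
case=> f0 fi fv [g0 gi gv]; split.
- exact: mulf_neq0.
- exact: SintM.
have e := invfM f g.
rewrite e.
exact: SintM.
Qed.
Lemma SunitV f : Sunit S f -> Sunit S f^-1.
Proof. by case=> f0 fi fv; split=> //; [apply: invr_neq0 | rewrite invrK]. Qed.

Variable c : F.
Local Notation D := (quat (cst c) tK).

(* A(o_S) *)
Definition Aint (w : D) : Prop :=
  [/\ Sint S (q1 w), Sint S (qz w), Sint S (qf w) & Sint S (qfz w)].

Lemma Aint1 : Aint 1.
Proof. by split; rewrite /=; by [apply: Sint1 | apply: Sint0]. Qed.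

Lemma AintM v w : Aint v -> Aint w -> Aint (v * w).
Proof.
have Sc : Sint S (cst c) by apply: Sint_fr.
have St : Sint S tK by apply: Sint_fr.
by case=> ? ? ? ? [? ? ? ?]; split=> /=; repeat first
  [exact: Sc | exact: St | assumption | apply: SintB | apply: SintD | apply: SintM].
Qed.

Definition Aunit : pred D :=
  fun w => `[< [/\ Aint w, w \is a GRing.unit & Aint w^-1] >].

Record agroup := AGroup { agval :> D; agvalP : Aunit agval }.
HB.instance Definition _ := [isSub for agval].
HB.instance Definition _ := [Choice of agroup by <:].

Lemma Aunit1 : Aunit 1.
Proof. by apply/asboolP; rewrite invr1 unitr1; split; [apply: Aint1| |apply: Aint1]. Qed.
Lemma AunitM (v w : agroup) : Aunit (agval v * agval w).
Proof.
case: v w => [v /= /asboolP[v1 v2 v3]] [w /= /asboolP[w1 w2 w3]].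
by apply/asboolP; rewrite unitrMr // invrM //; split => //; apply: AintM.
Qed.
Lemma AunitV (v : agroup) : Aunit (agval v)^-1.
Proof. by case: v => [v /= /asboolP[*]]; apply/asboolP; rewrite invrK unitrV. Qed.

Definition ag1 := AGroup Aunit1.
Definition agM v w := AGroup (AunitM v w).
Definition agV v := AGroup (AunitV v).
Lemma ag_unit (v : agroup) : agval v \is a GRing.unit.
Proof. by case: v => [v /= /asboolP[]]. Qed.
Lemma agMA : associative agM. Proof. by move=> ? ? ?; apply: val_inj; apply: mulrA. Qed.
Lemma ag1M : left_id ag1 agM. Proof. by move=> ?; apply: val_inj; apply: mul1r. Qed.
Lemma agM1 : right_id ag1 agM. Proof. by move=> ?; apply: val_inj; apply: mulr1. Qed.
Lemma agVM : left_inverse ag1 agV agM.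
Proof. by move=> v; apply: val_inj; apply: mulVr; apply: ag_unit. Qed.
Lemma agMV : right_inverse ag1 agV agM.
Proof. by move=> v; apply: val_inj; apply: divrr; apply: ag_unit. Qed.
HB.instance Definition _ := isGroup.Build agroup agMA ag1M agM1 agVM agMV.

(* Lambda_S = A(o_S)^x / o_S^x *)
Definition scal_eq (v w : agroup) : bool :=
  `[< exists2 u : K, Sunit S u & agval w = u *: agval v >].

Lemma scal_eq_refl : reflexive scal_eq.
Proof. by move=> v; apply/asboolP; exists 1; [apply: Sunit1 | rewrite scale1r]. Qed.
Lemma scal_eq_sym : symmetric scal_eq.
Proof.
suff h v w : scal_eq v w -> scal_eq w v by move=> v w; apply/idP/idP; apply: h.
move=> /asboolP[u hu e]; apply/asboolP; exists u^-1; first exact: SunitV.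
by rewrite e scalerA mulVf ?scale1r //; case: hu.
Qed.
Lemma scal_eq_trans : transitive scal_eq.
Proof.
move=> v u w /asboolP[x hx e1] /asboolP[y hy e2]; apply/asboolP.
by rewrite e2 e1 scalerA; exists (y * x) => //; apply: SunitM.
Qed.

Canonical scal_equiv := EquivRel scal_eq scal_eq_refl scal_eq_sym scal_eq_trans.
Definition Lambda := {eq_quot scal_equiv}%qT.
HB.instance Definition _ := Choice.on Lambda.
HB.instance Definition _ := Quotient.on Lambda.
Local Notation pi := (\pi_Lambda%qT).

Definition lam1 : Lambda := pi ag1.
Definition lamM (x y : Lambda) : Lambda := pi (agM (repr x) (repr y)).
Definition lamV (x : Lambda) : Lambda := pi (agV (repr x)).

Lemma pi_eqP v w : reflect (exists2 u : K, Sunit S u & agval w = u *: agval v) (pi v == pi w).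
Proof. by rewrite eqmodE; apply: asboolP. Qed.

Lemma lam_reprP v : exists2 u : K, Sunit S u & agval (repr (pi v)) = u *: agval v.
Proof. by apply/pi_eqP; rewrite reprK. Qed.

Lemma lamM_pi v w : lamM (pi v) (pi w) = pi (agM v w).
Proof.
apply/esym/eqP/pi_eqP; have [x hx ex] := lam_reprP v; have [y hy ey] := lam_reprP w.
exists (x * y); first exact: SunitM.
by rewrite /= ex ey -scalerAl -scalerAr scalerA.
Qed.

Lemma lamV_pi v : lamV (pi v) = pi (agV v).
Proof.
apply/esym/eqP/pi_eqP; have [x hx ex] := lam_reprP v.
exists x^-1; first exact: SunitV.
rewrite /= ex; apply: (mulrI (ag_unit v)); rewrite -scalerAr divrr ?ag_unit //.
have x0 : x != 0 by case: hx.
have ux : x *: agval v \is a GRing.unit.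
  by rewrite -ex; apply: ag_unit.
apply: (scalerI x0); rewrite scalerAl divrr // scalerA divff // scale1r.
by [].
Qed.

Lemma lamMA : associative lamM.
Proof.
elim/quotW=> x; elim/quotW=> y; elim/quotW=> z.
by rewrite (lamM_pi y z) (lamM_pi x y) !lamM_pi agMA.
Qed.
Lemma lam1M : left_id lam1 lamM.
Proof. by elim/quotW=> x; rewrite /lam1 lamM_pi ag1M. Qed.
Lemma lamM1 : right_id lam1 lamM.
Proof. by elim/quotW=> x; rewrite /lam1 lamM_pi agM1. Qed.
Lemma lamVM : left_inverse lam1 lamV lamM.
Proof. by elim/quotW=> x; rewrite lamV_pi lamM_pi agVM. Qed.
Lemma lamMV : right_inverse lam1 lamV lamM.
Proof. by elim/quotW=> x; rewrite lamV_pi lamM_pi agMV. Qed.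
HB.instance Definition _ := isGroup.Build Lambda lamMA lam1M lamM1 lamVM lamMV.


(* [w]; the default value of insubd is irrelevant for units w of A(o_S). *)
Definition cls (w : D) : Lambda := pi (insubd ag1 w).

Definition FqZ : set D := [set al | exists x y : F, al = (cst x)%:A + cst y *: qZ _ _].
Definition FqZ_norm (x : F) : set D :=
  [set al | FqZ al /\ al * qconj al = (cst x)%:A].
Definition zeta (al be : D) : D := (1 + al / be) / (1 + qconj al / qconj be).

(* [1 + al F] *)
Definition opF (al : D) : Lambda := cls (1 + al * qF _ _).

Definition PA (x : F) : set Lambda := opF @` FqZ_norm x^-1.

Lemma FqZ_normN x al : FqZ_norm x al -> FqZ_norm x (- al).
Proof.
case=> -[y [z ->]] h; split; last first.
  by rewrite -h; congr Quat => /=; ring.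
by exists (- y), (- z); congr Quat; rewrite /= /cst ?polyCN ?rmorphN /=; ring.
Qed.

Lemma opF_unit x al : x \in finplaces S -> FqZ_norm x^-1 al -> Aunit (1 + al * qF _ _).
Proof.
rewrite inE => /andP[x0 xS] nal.
pose u : K := 1 - cst x^-1 * tK.
have key be : FqZ_norm x^-1 be -> (1 + be * qF _ _) * (1 - be * qF _ _) = u%:A.
  case=> -[y [z ->]] h; have /(congr1 (@q1 _ _ _)) /= e := h.
  have {}e : cst x^-1 = cst y ^+ 2 - cst c * cst z ^+ 2 by move: e => /= e; rewrite -[LHS]mulr1 -e; ring.
  by rewrite /u e; congr Quat => /=; ring.
have uE : u = fr ('X - x%:P) * (- cst x^-1).
  rewrite /u rmorphB mulrN mulrBl -/(cst x) -/tK.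
  have -> : cst x * cst x^-1 = 1.
    by rewrite /cst -rmorphM -polyCM divff // rmorph1.
  by ring.
have cx0 : cst x^-1 != 0.
  by rewrite /cst -(rmorph0 fr) (inj_eq (@fr_inj _ K)) polyC_eq0 invr_eq0.
have u0 : u != 0.
  rewrite uE mulf_neq0 ?oppr_eq0 // -(rmorph0 fr) (inj_eq (@fr_inj _ K)).
  by rewrite polyXsubC_eq0.
have Su : Sint S u^-1.
  move=> P mP irrP nP; exists (- x%:P), ('X - x%:P); split.
    apply/negP => h; apply: (nP x xS).
    have := irredp_XsubC x => -[_ /(_ P)]; rewrite h neq_ltn; case: irrP => -> _.
    rewrite orbT => /(_ isT isT) e; apply/eqP; rewrite -eqp_monic //.
    exact: monicXsubC.
  rewrite uE invfM mulrC; congr (_ / _).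
  rewrite rmorphN invrN; congr (- _); rewrite /cst.
  apply: (mulIf cx0); rewrite mulVf // -rmorphM -polyCM divff //.
  by rewrite rmorph1.
have Aop be : FqZ be -> Aint (1 + be * qF _ _).
  case=> y [z ->].
  have -> : 1 + ((cst y)%:A + cst z *: qZ _ _) * qF _ _ =
      Quat 1 0 (cst y) (cst (- z)) :> D.
    by rewrite /cst polyCN rmorphN; congr Quat => /=; ring.
  by split; rewrite /= /cst; first [exact: Sint0 | exact: Sint1 | exact: Sint_fr].
have nal' := FqZ_normN nal.
have k1 := key _ nal; have k2 := key _ nal'.
rewrite mulNr opprK in k2.
have uw : (1 + al * qF _ _) \is a GRing.unit.
  apply/unitrP; exists (u^-1 *: (1 - al * qF _ _)).
  by rewrite -scalerAl -scalerAr k1 k2 !scalerA mulVf // scale1r.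
apply/asboolP; split=> //; first exact: (Aop _ nal.1).
have -> : (1 + al * qF _ _)^-1 = u^-1 *: (1 - al * qF _ _).
  by apply: (mulrI uw); rewrite divrr // -scalerAr k1 scalerA mulVf // scale1r.
have := Aop _ nal'.1; rewrite mulNr => -[h1 h2 h3 h4].
by split; rewrite /=; apply: SintM.
Qed.

End FunctionField.
Arguments PA {F} K S c x.

Section Presentations.

Definition gensub (G : groupType) (X : set G) : set G :=
  [set g | forall H : set G, H 1%g ->
    (forall x y, H x -> H y -> H (x * y)%g) -> (forall x, H x -> H x^-1%g) ->
    X `<=` H -> H g].

(* Words in the letters x = (x, true) and x^-1 = (x, false). *)
Definition word (X : Type) := seq (X * bool).

Definition weval (X : Type) (G : groupType) (f : X -> G) (w : word X) : G :=
  (\prod_(l <- w) (if l.2 then f l.1 else (f l.1)^-1))%g.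

(* Equality of words in the group <X | R>. *)
Inductive pres_eq (X : Type) (R : word X -> word X -> Prop) : word X -> word X -> Prop :=
| PresRefl u : pres_eq R u u
| PresSym u v : pres_eq R u v -> pres_eq R v u
| PresTrans u v w : pres_eq R u v -> pres_eq R v w -> pres_eq R u w
| PresCat u u' v v' : pres_eq R u u' -> pres_eq R v v' -> pres_eq R (u ++ v) (u' ++ v')
| PresCancel x b : pres_eq R [:: (x, b); (x, ~~ b)] [::]
| PresRel u v : R u v -> pres_eq R u v.

(* The evaluation of words induces an isomorphism from <X | R> onto the       *)
(* subgroup H of G.                                                           *)
Definition has_presentation (G : groupType) (H : set G) (X : Type) (f : X -> G)
    (R : word X -> word X -> Prop) : Prop :=
  range (weval f) = H /\
  forall u v : word X, weval f u = weval f v <-> pres_eq R u v.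

End Presentations.

Section Gamma.
Variables (F : finFieldType) (K : ratfun F) (S : rplaces F) (c : F).

Definition gens : set (Lambda K S c) :=
  \bigcup_(x in [set x | x \in finplaces S]) PA K S c x.

Definition Gamma : set (Lambda K S c) := gensub gens.

Inductive square_rel : word (set_type gens) -> word (set_type gens) -> Prop :=
| RelInv (t : F) al (x y : set_type gens) :
    t \in finplaces S -> FqZ_norm t^-1 al ->
    val x = opF S al -> val y = opF S (- al) ->
    square_rel [:: (x, true); (y, true)] [::]
| RelSquare (t s : F) al be (x y z w : set_type gens) :
    t \in finplaces S -> s \in finplaces S -> t <> s ->
    FqZ_norm t^-1 al -> FqZ_norm s^-1 be ->
    val x = opF S al -> val y = opF S be ->
    val z = opF S (zeta al be * be) -> val w = opF S (zeta be al * al) ->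
    square_rel [:: (x, true); (y, true)] [:: (z, true); (w, true)].
End Gamma.
Arguments gens {F} K S c.
Arguments Gamma {F} K S c.
Arguments square_rel {F} K S c.

Section Tree.
(* v is a discrete valuation on L; its value at 0 is irrelevant. *)
Variables (L : fieldType) (v : L -> int).

Definition val_ge (n : int) (x : L) := x = 0 \/ n <= v x.

Definition lattice (M : set 'cV[L]_2) := exists2 g : 'M[L]_2, g \in unitmx &
  M = [set g *m u | u in [set u : 'cV[L]_2 | forall i, val_ge 0 (u i ord0)]].

Definition homothety_class (M : set 'cV[L]_2) : set (set 'cV[L]_2) :=
  [set N | exists2 a : L, a != 0 & N = [set a *: u | u in M]].

Definition vertex (X : set (set 'cV[L]_2)) :=
  exists2 M, lattice M & X = homothety_class M.

Definition edge (X Y : set (set 'cV[L]_2)) :=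
  [/\ vertex X, vertex Y & exists M N (p : L),
    [/\ X M, Y N, p != 0 /\ v p = 1, [set p *: u | u in M] `<` N & N `<` M]].

(* Cells, as sets of vertices. *)
Definition cell (C : set (set (set 'cV[L]_2))) :=
  (exists2 X, vertex X & C = [set X]) \/ (exists X Y, edge X Y /\ C = [set X; Y]).

Definition mact (g : 'M[L]_2) (X : set (set 'cV[L]_2)) : set (set 'cV[L]_2) :=
  [set [set g *m u | u in M] | M in X].
End Tree.

Section Action.
Variables (F : finFieldType) (K : ratfun F).

(* A completion of K at the place t = x. *)
Record completion (x : F) := Completion {
  cfield :> fieldType;
  cemb : {rmorphism K -> cfield};
  cval : cfield -> int;
  cvalM : forall a b, a != 0 -> b != 0 -> cval (a * b) = cval a + cval b;
  cvalD : forall n a b, val_ge cval n a -> val_ge cval n b -> val_ge cval n (a + b);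
  cval_fr : forall p : {poly F}, p != 0 -> cval (cemb (fr K p)) = (mup x p)%:Z;
  cdense : forall (a : cfield) (n : int), exists f : K, val_ge cval n (a - cemb f);
  ccomplete : forall u : nat -> cfield,
    (forall n : int, exists N, forall i j, (N <= i)%N -> (N <= j)%N ->
      val_ge cval n (u i - u j)) ->
    exists l, forall n : int, exists N, forall i, (N <= i)%N -> val_ge cval n (u i - l) }.

Arguments cval {x} c _.
Variable c : F.

(* K_v together with an isomorphism D (x)_K K_v = M_2(K_v). *)
Record splitting (x : F) := Splitting {
  scomp :> completion x;
  sphi : {lrmorphism quat (cemb scomp (cst K c)) (cemb scomp (tK K)) -> 'M[scomp]_2};
  sphi_bij : bijective sphi }.

Variable S : rplaces F.

(* The action of [w] is that of w, see [lam_act_cls]. *)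
Definition lam_act (x : F) (T : splitting x) (g : Lambda K S c) (X : set (set 'cV[T]_2)) :=
  mact (sphi T (qmap (cemb T) (agval (repr g)))) X.

Arguments lam_act [x] T g X.

Lemma macts (L : fieldType) (a : L) (g : 'M[L]_2) (M : set 'cV[L]_2) : a != 0 ->
  mact (a *: g) (homothety_class M) = mact g (homothety_class M).
Proof.
move=> a0; have scl b (N : set 'cV[L]_2) : b != 0 -> homothety_class M N ->
    homothety_class M [set b *: u | u in N].
  move=> b0 [d d0 ->]; exists (b * d); first by rewrite mulf_neq0.
  by rewrite image_comp; congr image; apply/funext => u /=; rewrite scalerA.
apply/seteqP; split=> _ [N XN <-].
  exists [set a *: u | u in N]; first exact: scl.
  rewrite image_comp; congr image; apply/funext => u /=.
  by rewrite -scalemxAr scalemxAl.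
exists [set a^-1 *: u | u in N]; first by apply: scl => //; rewrite invr_eq0.
rewrite image_comp; congr image; apply/funext => u /=.
by rewrite -scalemxAr -scalemxAl scalerA mulVf // scale1r.
Qed.

Lemma lam_act_cls (x : F) (T : splitting x) (w : agroup K S c) (X : set (set 'cV[T]_2)) :
  vertex (cval T) X ->
  lam_act T (cls S (agval w)) X = mact (sphi T (qmap (cemb T) (agval w))) X.
Proof.
case=> M _ ->; rewrite /lam_act /cls.
have -> : insubd (ag1 K S c) (agval w) = w by exact: valKd.
have [u [u0 _ _] ->] := lam_reprP w.
have -> : qmap (cemb T) (u *: agval w) = cemb T u *: qmap (cemb T) (agval w).
  by congr Quat; rewrite /= rmorphM.
by rewrite linearZ macts // fmorph_eq0.
Qed.

Variable T : forall x : {x : F | x \in finplaces S}, splitting (val x).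

(* A cell of the product of the trees is a family of cells, one for each v in S_0. *)
Definition cube (C : forall x, set (set (set 'cV[T x]_2))) :=
  forall x, cell (cval (T x)) (C x).

Definition cube_act (g : Lambda K S c) (C : forall x, set (set (set 'cV[T x]_2))) :
    forall x, set (set (set 'cV[T x]_2)) :=
  fun x => [set lam_act (T x) g X | X in C x].
End Action.

(* Main.v *)
(* A product P of elements 1 + aF is a quaternion over F_q[t] that is 1 modulo F.

Presentation: the square relations hold exactly in the quaternions over F_q[t].
They move all letters belonging to the place tau of the first letter to the front
of a positive word.  If these letters form a reduced word, their product does not
vanish at t = tau, whereas its norm does; as the remaining letters have norm
invertible at tau, the whole product is not a scalar.  Hence a word representing
1 can be shortened.

Torsion: if P^n is a scalar then P^n = P'^n for the conjugate P' of P.  If n is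
invertible in F_q, the cofactor of P - P' in P^n - P'^n has constant term n, so it
is invertible in the division algebra D and P = P' is a scalar; the prime p itself
is handled by the Frobenius identity P^p - P'^p = (P - P')^p.

Free action: if g stabilises a cell then Q = P^2 fixes a vertex in each tree, so up
to a scalar R the powers Q^n are bounded at every place of S_0, while their norms
bound them at 0 and oo, where D is ramified.  Thus the Q^n / R^n take finitely many
values, g has finite order, and g = 1 because Gamma is torsion-free. *)
Require Import Defs.
From mathcomp Require Import all_boot all_order all_algebra.
From mathcomp Require Import boolp classical_sets ring zify.

Set Implicit Arguments.
Unset Strict Implicit.
Unset Printing Implicit Defensive.

Import Order.TTheory GRing.Theory Num.Theory.
Local Open Scope classical_set_scope.
Local Open Scope ring_scope.

Lemma exprB_pchar_comm (R : nzRingType) p (x y : R) :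
  p \in [pchar R] -> GRing.comm x y -> (x - y) ^+ p = x ^+ p - y ^+ p.
Proof. by move=> pR xy; rewrite -!(pFrobenius_autE pR) pFrobenius_autB_comm. Qed.

(** * Quaternions *)

Section QuatBasics.
Variables (R : comNzRingType) (a b : R).
Implicit Types x y : quat a b.

Lemma quat_scalarE (r : R) : r%:A = Quat r 0 0 0 :> quat a b.
Proof. by congr Quat => /=; ring. Qed.

Lemma qconjM x y : qconj (x * y) = qconj y * qconj x.
Proof. by case: x y => ? ? ? ? [? ? ? ?]; congr Quat => /=; ring. Qed.

Lemma qconjX x n : qconj (x ^+ n) = qconj x ^+ n.
Proof.
elim: n => [|n IH]; first by congr Quat; rewrite /= oppr0.
by rewrite exprS qconjM IH -exprSr.
Qed.

Lemma qconj_scalar (r : R) : qconj (r%:A : quat a b) = r%:A.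
Proof. by rewrite quat_scalarE; congr Quat; rewrite oppr0. Qed.

Lemma qconj_comm x : GRing.comm x (qconj x).
Proof. by rewrite /GRing.comm qmulJ qmulJl. Qed.

Lemma nrd_conj x : nrd (qconj x) = nrd x.
Proof. by rewrite /nrd /=; ring. Qed.

Lemma nrdX x n : nrd (x ^+ n) = nrd x ^+ n.
Proof. by elim: n => [|n IH]; rewrite ?nrd1 // exprS nrdM IH -exprS. Qed.

Lemma nrd_scalar (r : R) : nrd (r%:A : quat a b) = r ^+ 2.
Proof. by rewrite quat_scalarE /nrd /=; ring. Qed.

Lemma nrdZ (r : R) x : nrd (r *: x) = r ^+ 2 * nrd x.
Proof. by rewrite /nrd /=; ring. Qed.

Lemma q1_sum (I : Type) (r : seq I) (f : I -> quat a b) :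
  q1 (\sum_(i <- r) f i) = \sum_(i <- r) q1 (f i).
Proof. by apply: (big_morph (@q1 R a b)). Qed.

Lemma qz_sum (I : Type) (r : seq I) (f : I -> quat a b) :
  qz (\sum_(i <- r) f i) = \sum_(i <- r) qz (f i).
Proof. by apply: (big_morph (@qz R a b)). Qed.

Lemma pchar_quat p : p \in [pchar R] -> p \in [pchar (quat a b)].
Proof.
rewrite !inE => /andP[-> /eqP p0] /=; rewrite -scaler_nat.
by rewrite p0 scale0r.
Qed.
End QuatBasics.

Section QuatDomain.
Variables (R : idomainType) (a b : R).
Implicit Types x y : quat a b.

Lemma quat_scaler_eq0 (r : R) x : r != 0 -> r *: x = 0 -> x = 0.
Proof.
move=> r0; case: x => x1 x2 x3 x4 [] /eqP + /eqP + /eqP + /eqP.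
by rewrite !mulf_eq0 (negbTE r0) => /eqP-> /eqP-> /eqP-> /eqP->.
Qed.

Lemma quat_mul_eq0r x y : nrd x != 0 -> x * y = 0 -> y = 0.
Proof.
move=> x0 xy; apply: (@quat_scaler_eq0 (nrd x)) => //.
by rewrite -[y]mul1r scalerAl -qmulJl -mulrA xy mulr0.
Qed.

Lemma quat_mul_eq0l x y : nrd y != 0 -> x * y = 0 -> x = 0.
Proof.
move=> y0 xy; apply: (@quat_scaler_eq0 (nrd y)) => //.
by rewrite -[x]mulr1 scalerAr -qmulJ mulrA xy mul0r.
Qed.

Lemma self_conj_scalar x : 2%:R != 0 :> R -> qconj x = x -> x = (q1 x)%:A.
Proof.
move=> two0; have opp0 (u : R) : - u = u -> u = 0.
  move=> /esym /eqP; rewrite -subr_eq0 opprK -mulr2n -mulr_natl mulf_eq0.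
  by rewrite (negbTE two0) => /eqP.
by case: x => x1 x2 x3 x4; rewrite quat_scalarE => -[/opp0-> /opp0-> /opp0->].
Qed.
End QuatDomain.

Section QuatMapMorphism.
Variables (R R' : comNzRingType) (a b : R) (f : {rmorphism R -> R'}).
Implicit Types x y : quat a b.

Lemma qmapM x y : qmap f (x * y) = qmap f x * qmap f y.
Proof. by congr Quat; rewrite /= !(rmorphB, rmorphD, rmorphM). Qed.

Lemma qmapZ r x : qmap f (r *: x) = f r *: qmap f x.
Proof. by congr Quat; rewrite /= rmorphM. Qed.

Lemma qmap1 : qmap f (1 : quat a b) = 1.
Proof. by congr Quat; rewrite /= ?rmorph1 ?rmorph0. Qed.

Lemma qmapX x n : qmap f (x ^+ n) = qmap f x ^+ n.
Proof. by elim: n => [|n IH]; rewrite ?qmap1 // !exprS qmapM IH. Qed.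

Lemma nrd_qmap x : nrd (qmap f x) = f (nrd x).
Proof. by rewrite /nrd /= !(rmorphB, rmorphD, rmorphM, rmorphXn). Qed.

Lemma qmap_conj x : qmap f (qconj x) = qconj (qmap f x).
Proof. by congr Quat; rewrite /= rmorphN. Qed.
End QuatMapMorphism.

(** * The norm form over F_q[t] and torsion *)

Section NormForm.
Variables (F : finFieldType) (c : F).
Hypothesis c_nonsquare : forall x : F, x ^+ 2 != c.
Local Notation A := (quat c%:P 'X).

(** In characteristic 2 squaring would be injective, hence onto the finite field, and [c] would be a
    square. *)
Lemma nonsquare_two_neq0 : 2%:R != 0 :> F.
Proof.
apply/eqP => two0; have inj : injective (fun x : F => x ^+ 2).
  move=> x y /= /eqP; rewrite -subr_eq0 => /eqP e.
  have : (x - y) ^+ 2 = 0.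
    have -> : (x - y) ^+ 2 = x ^+ 2 - y ^+ 2 - 2%:R * (y * (x - y)) by ring.
    by rewrite e two0 mul0r subr0.
  by move=> /eqP; rewrite expf_eq0 subr_eq0 => /eqP.
have [g _ gK] := injF_bij inj.
by move: (c_nonsquare (g c)); rewrite gK eqxx.
Qed.

Lemma norm2_eq0 (x y : F) : x ^+ 2 - c * y ^+ 2 = 0 -> x = 0 /\ y = 0.
Proof.
move=> e; have [y0|y0] := eqVneq y 0.
  by move: e; rewrite y0 expr0n mulr0 subr0 => /eqP; rewrite expf_eq0 => /eqP.
case/eqP: (c_nonsquare (x / y)); rewrite expr_div_n.
by apply: (canLR (mulfK _)); [rewrite expf_neq0 | apply/eqP; rewrite -subr_eq0 e].
Qed.

(** Cancellation of leading terms is possible only for equal degrees; the top coefficient is then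
    the norm form at two leading coefficients, which is anisotropic. The truncated predecessor makes
    the formula right for [f = g = 0]. *)
Lemma size_norm2 (f g : {poly F}) :
  size (f ^+ 2 - c%:P * g ^+ 2) = (maxn (size f) (size g)).*2.-1.
Proof.
have c0 : c != 0 by move: (c_nonsquare 0); rewrite expr0n eq_sym.
have sX (h : {poly F}) : size (h ^+ 2) = (size h).*2.-1.
  have [->|h0] := eqVneq h 0; first by rewrite expr0n size_poly0.
  by rewrite expr2 size_mul // addnn.
have sc (h : {poly F}) : size (c%:P * h ^+ 2) = (size h).*2.-1.
  by rewrite mul_polyC size_scale.
have [lt|lt|e] := ltngtP (size f) (size g).
- by rewrite addrC size_polyDl ?size_polyN ?sc ?sX //; lia.
- by rewrite size_polyDl ?size_polyN ?sc ?sX //; lia.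
have [f0|f0] := eqVneq f 0.
  move: e; rewrite f0 size_poly0 => /esym/eqP; rewrite size_poly_eq0 => /eqP->.
  by rewrite expr0n mulr0 subr0 size_poly0.
have g0 : g != 0 by rewrite -size_poly_eq0 -e size_poly_eq0.
apply/eqP; rewrite eqn_leq; apply/andP; split.
  by rewrite (leq_trans (size_polyD _ _)) // size_polyN sX sc -e maxnn.
rewrite leqNgt; apply/negP => lt.
have coefX (h : {poly F}) : (h ^+ 2)`_((size h).*2.-2) = lead_coef h ^+ 2.
  by rewrite -lead_coef_exp lead_coefE sX.
have : (f ^+ 2 - c%:P * g ^+ 2)`_((size f).*2.-2) = 0.
  by apply: nth_default; rewrite -ltnS (ltn_predK lt).
rewrite coefB coefCM {2}e !coefX => /norm2_eq0 [] /eqP.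
by rewrite lead_coef_eq0 (negbTE f0).
Qed.

Lemma nrd_split (x : A) :
  nrd x = (q1 x ^+ 2 - c%:P * qz x ^+ 2) - 'X * (qf x ^+ 2 - c%:P * qfz x ^+ 2).
Proof. by rewrite /nrd; ring. Qed.

(* The two binary forms in [nrd_split] contribute degrees of opposite parity, so
   that their leading terms cannot cancel. *)
Lemma size_nrd_ge (x : A) :
  (maxn (maxn (size (q1 x)) (size (qz x))) (maxn (size (qf x)) (size (qfz x)))
   <= size (nrd x))%N.
Proof.
rewrite nrd_split; set u := q1 x ^+ 2 - _; set v := qf x ^+ 2 - _.
have := size_norm2 (q1 x) (qz x); have := size_norm2 (qf x) (qfz x).
rewrite -/u -/v; set m := maxn (size (q1 x)) _; set n := maxn (size (qf x)) _ => sv su.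
have sXv : size ('X * v) = if n == 0%N then 0%N else n.*2.
  have [v0|v0] := eqVneq v 0.
    by move: sv; rewrite v0 mulr0 size_poly0; case: eqP => // ?; lia.
  rewrite mulrC size_mulX //; move: v0; rewrite -size_poly_gt0 sv.
  by case: eqP => ?; lia.
have [lt|le] := ltnP (size ('X * v)) (size u).
  rewrite size_polyDl ?size_polyN // su.
  by move: lt; rewrite sXv su; case: eqP => ?; lia.
have [lt|ge] := ltnP (size u) (size ('X * v)).
  rewrite addrC size_polyDl ?size_polyN //.
  by move: lt; rewrite sXv su; case: eqP => ?; lia.
(* Equal sizes would make an odd number even, unless both forms vanish. *)
by move: le ge; rewrite sXv su; case: eqP => ?; lia.
Qed.

Lemma nrd_eq0 (x : A) : nrd x = 0 -> x = 0.
Proof.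
move=> x0; have := size_nrd_ge x; rewrite x0 size_poly0.
rewrite !geq_max !leqn0 !size_poly_eq0; case: x {x0} => /= x1 x2 x3 x4.
by move=> /andP[/andP[/eqP-> /eqP->] /andP[/eqP-> /eqP->]].
Qed.

(* [x] is congruent to 1 modulo the two-sided ideal generated by F. *)
Definition one_mod_F (x : A) := (q1 x).[0] = 1 /\ (qz x).[0] = 0.

Lemma one_mod_FM (x y : A) : one_mod_F x -> one_mod_F y -> one_mod_F (x * y).
Proof.
move=> [x1 x2] [y1 y2]; split;
  by rewrite /= !(hornerD, hornerN, hornerM, hornerC, hornerX) x1 x2 y1 y2; ring.
Qed.

Lemma one_mod_FX (x : A) n : one_mod_F x -> one_mod_F (x ^+ n).
Proof.
move=> x1; elim: n => [|n IH]; first by split; rewrite /= hornerE.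
by rewrite exprS; apply: one_mod_FM.
Qed.

Lemma one_mod_F_conj (x : A) : one_mod_F x -> one_mod_F (qconj x).
Proof. by move=> [x1 x2]; split; rewrite /= ?hornerE ?x2 ?oppr0. Qed.

Lemma one_mod_F_torsion (x : A) (r : {poly F}) n :
  one_mod_F x -> (0 < n)%N -> x ^+ n = r%:A -> qconj x = x.
Proof.
(* The induction runs on [x ^+ n = qconj x ^+ n], a form that survives division of the exponent by
   the characteristic. *)
move=> x1 n0 xn; have {r xn} : x ^+ n = qconj x ^+ n.
  by rewrite -qconjX xn qconj_scalar.
elim/ltn_ind: n n0 => n IH n0 xn.
have cx := qconj_comm x.
have [nF|nF] := eqVneq (n%:R : F) 0.
  (* For [n = m p] Frobenius gives [(x^m - x'^m)^p = x^n - x'^n = 0], where x' is the conjugate;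
     anisotropy of the norm then yields the equation for [m]. *)
  have /natf0_pchar [//|p pF] : n%:R == 0 :> F by rewrite nF.
  have p_pr := pcharf_prime pF.
  have /dvdnP [m nE] : (p %| n)%N by rewrite (dvdn_pcharf pF) nF.
  have m0 : (0 < m)%N by rewrite lt0n; apply: contraTneq n0 => m0; rewrite nE m0.
  apply: (IH m) => //; first by rewrite nE ltn_Pmulr ?prime_gt1.
  have pA : p \in [pchar A].
    by apply: pchar_quat; rewrite pchar_poly.
  have cm : GRing.comm (x ^+ m) (qconj x ^+ m).
    by apply: commrX; apply: commr_sym; apply: commrX; apply: commr_sym.
  apply/eqP; rewrite -subr_eq0; apply/eqP/nrd_eq0/eqP.
  suff /eqP : nrd (x ^+ m - qconj x ^+ m) ^+ p = 0.
    by rewrite expf_eq0 => /andP[].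
  rewrite -nrdX (exprB_pchar_comm pA cm).
  by rewrite -!exprM -nE xn subrr /nrd /= !expr0n /= !mulr0 !subr0 addr0.
have := subrXX_comm n cx; rewrite xn subrr => /esym.
move=> /quat_mul_eq0l h; apply/esym/eqP; rewrite -subr_eq0; apply/eqP/h.
(* Each summand is congruent to 1 modulo F, so only its first coordinate contributes to the constant
   term of [nrd y]. *)
set y := \sum_(i < n) _.
have y0 : (nrd y).[0] = n%:R ^+ 2.
  have e i : one_mod_F (x ^+ (n.-1 - i) * qconj x ^+ i).
    by apply: one_mod_FM; apply: one_mod_FX => //; apply: one_mod_F_conj.
  rewrite nrd_split !(hornerD, hornerN, hornerM, hornerC, hornerX, horner_exp).
  rewrite q1_sum qz_sum !horner_sum.
  rewrite (eq_bigr (fun=> 1)) => [|i _]; last by case: (e i).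
  rewrite sumr_const card_ord [X in c * X ^+ 2]big1 => [|i _]; last by case: (e i).
  by ring.
apply: contraNneq nF => y00; move: y0; rewrite y00 horner0 => /esym/eqP.
by rewrite expf_eq0.
Qed.
End NormForm.

(** * The square relations *)

Section Letters.
Variables (F : finFieldType) (c : F).
Hypothesis c_nonsquare : forall x : F, x ^+ 2 != c.
Local Notation A := (quat c%:P 'X).
Local Notation E := (F * F)%type.
Implicit Types a b g : E.

(* [(x, y) : E] stands for [x + y Z]. *)
Definition normE a : F := a.1 ^+ 2 - c * a.2 ^+ 2.
Definition mulE a b : E := (a.1 * b.1 + c * (a.2 * b.2), a.1 * b.2 + a.2 * b.1).
Definition conjE a : E := (a.1, - a.2).
Definition oppE a : E := (- a.1, - a.2).
Definition addE a b : E := (a.1 + b.1, a.2 + b.2).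
Definition invE a : E := (a.1 / normE a, - a.2 / normE a).

(* The first letter of the second side of a square:
   [zeta_a(b) b = conj b (a + b) / conj (a + b)] *)
Definition turnE a b : E :=
  mulE (conjE b) (mulE (addE a b) (invE (conjE (addE a b)))).

(** The element 1 + aF; the sign is due to ZF = -FZ, the basis being 1, Z, F, FZ. *)
Definition op a : A := Quat 1 0 a.1%:P (- a.2)%:P.

Lemma normE_eq0 a : normE a = 0 -> a = (0, 0).
Proof. by case: a => x y /(norm2_eq0 c_nonsquare) /= [-> ->]. Qed.

Lemma normEM a b : normE (mulE a b) = normE a * normE b.
Proof. by rewrite /normE /=; ring. Qed.

Lemma normE_opp a : normE (oppE a) = normE a.
Proof. by rewrite /normE /= !sqrrN. Qed.

Lemma oppEK : involutive oppE.
Proof. by case=> x y; rewrite /oppE /= !opprK. Qed.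

Lemma normE_conj a : normE (conjE a) = normE a.
Proof. by rewrite /normE /= sqrrN. Qed.

Lemma normEV a : normE a != 0 -> normE (invE a) = (normE a)^-1.
Proof.
move=> a0; transitivity (normE a / normE a ^+ 2); last by field.
by rewrite /invE {1 4}/normE /=; field.
Qed.

Lemma addE_neq0 a b : normE a != normE b -> normE (addE a b) != 0.
Proof.
apply: contra_neq => /normE_eq0 [/eqP + /eqP].
by rewrite !addr_eq0 /normE => /eqP-> /eqP->; rewrite !sqrrN.
Qed.

Lemma addEC a b : addE a b = addE b a.
Proof. by rewrite /addE addrC [_.2 + _]addrC. Qed.

Lemma normE_unitary s : normE s != 0 -> normE (mulE s (invE (conjE s))) = 1.
Proof. by move=> s0; rewrite normEM normEV normE_conj ?divff. Qed.

Lemma mulE_unitary s : normE s != 0 -> mulE (conjE s) (mulE s (invE (conjE s))) = s.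
Proof.
case: s => x y s0; rewrite /mulE /invE normE_conj /=.
by congr pair; rewrite /normE /=; field.
Qed.

Lemma normE_turn a b : normE a != normE b -> normE (turnE a b) = normE b.
Proof.
move=> /addE_neq0 s0.
by rewrite /turnE normEM normE_unitary // mulr1 normE_conj.
Qed.

Lemma opM a b :
  op a * op b = let p := mulE a (conjE b) in let s := addE a b in
    Quat (1 + p.1%:P * 'X) (p.2%:P * 'X) s.1%:P (- s.2)%:P.
Proof.
by congr Quat; rewrite /= !(polyCD, polyCM, polyCN); ring.
Qed.

(** By [opM] the product depends only on [a + b] and [a (conj b)]. With [w = s / conj s] for
    [s = a + b], the new letters are [w (conj b)] and [w (conj a)]: their sum is [w (conj s) = s],
    and the other invariant is multiplied by [N(w) = 1]. *)
Lemma op_square a b : normE a != normE b ->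
  op a * op b = op (turnE a b) * op (turnE b a).
Proof.
move=> /addE_neq0 s0.
suff [e1 e2] : mulE a (conjE b) = mulE (turnE a b) (conjE (turnE b a)) /\
    addE a b = addE (turnE a b) (turnE b a) by rewrite !opM e1 e2.
rewrite /turnE [addE b a]addEC.
have := mulE_unitary s0; have := normE_unitary s0; move: (mulE (addE a b) _) => w w1 ws.
split; last by rewrite -{1}ws; congr pair; rewrite /=; ring.
transitivity (normE w * (mulE a (conjE b)).1, normE w * (mulE a (conjE b)).2).
  by rewrite w1 !mul1r.
by congr pair; rewrite /normE /=; ring.
Qed.

Lemma op_inv a : op a * op (oppE a) = (1 - normE a *: 'X)%:A.
Proof.
rewrite opM quat_scalarE -mul_polyC; congr Quat => /=; rewrite ?subrr ?oppr0 //;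
  rewrite /normE !(polyCB, polyCM, polyCD, polyC_exp, polyCN); ring.
Qed.
End Letters.

(** * The field F_q[Z] inside D *)

Section Embedding.
Variables (F : finFieldType) (K : ratfun F) (S : rplaces F) (c : F).
Hypothesis c_nonsquare : forall x : F, x ^+ 2 != c.
Local Notation A := (quat c%:P 'X).
Local Notation D := (quat (cst K c) (tK K)).
Local Notation E := (F * F)%type.
Local Notation Lam := (Lambda K S c).
Implicit Types a b : E.

Definition qK : A -> D := qmap (fr K).
Definition eD a : D := Quat (cst K a.1) (cst K a.2) 0 0.

Lemma cstM x y : cst K (x * y) = cst K x * cst K y.
Proof. by rewrite /cst polyCM rmorphM. Qed.
Lemma cstD x y : cst K (x + y) = cst K x + cst K y.
Proof. by rewrite /cst polyCD rmorphD. Qed.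
Lemma cstN x : cst K (- x) = - cst K x.
Proof. by rewrite /cst polyCN rmorphN. Qed.
Lemma cst0 : cst K 0 = 0.
Proof. by rewrite /cst rmorph0. Qed.
Lemma cst1 : cst K 1 = 1.
Proof. by rewrite /cst !rmorph1. Qed.
Lemma cst_inj : injective (cst K).
Proof. by move=> x y /(@fr_inj _ K) /polyC_inj. Qed.

Lemma qK_op a : qK (op c a) = 1 + eD a * qF _ _.
Proof.
rewrite /qK /qmap /op /= rmorph1 rmorph0 polyCN rmorphN -!/(cst K _).
by congr Quat => /=; ring.
Qed.

Lemma eD1 : 1 = eD (1, 0).
Proof. by rewrite /eD cst1 cst0. Qed.

Lemma eDD a b : eD a + eD b = eD (addE a b).
Proof. by congr Quat; rewrite /= ?cstD ?addr0. Qed.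

Lemma eDM a b : eD a * eD b = eD (mulE c a b).
Proof. by congr Quat; rewrite /= ?(cstD, cstM); ring. Qed.

Lemma eD_comm a b : eD a * eD b = eD b * eD a.
Proof. by congr Quat; rewrite /=; ring. Qed.

Lemma eD_conj a : qconj (eD a) = eD (conjE a).
Proof. by congr Quat; rewrite /= ?cstN ?oppr0. Qed.

Lemma eD_unit a : normE c a != 0 -> eD a \is a GRing.unit.
Proof.
move=> a0; rewrite -[_ \is a _]/(nrd (eD a) != 0).
have -> : nrd (eD a) = cst K (normE c a).
  by rewrite /nrd /normE !expr2 /= cstD cstN !cstM; ring.
by rewrite -cst0 (inj_eq cst_inj).
Qed.

Lemma eDV a : normE c a != 0 -> (eD a)^-1 = eD (invE c a).
Proof.
move=> a0; apply: (mulrI (eD_unit a0)); rewrite divrr ?eD_unit // eDM eD1.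
by congr eD; rewrite /mulE /invE; congr pair; rewrite /normE /=; field.
Qed.

Lemma FqZ_normP x (al : D) : FqZ_norm x al <-> exists2 a, normE c a = x & al = eD a.
Proof.
have eDE y z : (cst K y)%:A + cst K z *: qZ _ _ = eD (y, z) :> D.
  by congr Quat => /=; ring.
have eDJ a : eD a * qconj (eD a) = (cst K (normE c a))%:A.
  rewrite eD_conj eDM quat_scalarE /eD.
  have -> : (mulE c a (conjE a)).1 = normE c a by rewrite /normE /=; ring.
  by have -> : (mulE c a (conjE a)).2 = 0 by [rewrite /=; ring]; rewrite cst0.
split=> [[[y [z ->]]]|[[y z] <- ->]]; rewrite ?eDE.
  rewrite eDJ !quat_scalarE => -[/cst_inj e].
  by exists (y, z).
by split; [exists y, z; rewrite eDE | rewrite eDJ].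
Qed.

(** Let p and r be the numerator and the denominator of zeta. Then [p b = a + b] and
    [r (conj b) = conj (a + b)], and since F_q[Z] is commutative, [(p / r) b] is
    [(conj b) (a + b) / conj (a + b)]. *)
Lemma zeta_turn a b : normE c a != normE c b -> normE c b != 0 ->
  zeta (eD a) (eD b) * eD b = eD (turnE c a b).
Proof.
move=> ab b0; have s0 := addE_neq0 c_nonsquare ab; rewrite /zeta.
have cb0 : normE c (conjE b) != 0 by rewrite normE_conj.
have cs0 : normE c (conjE (addE a b)) != 0 by rewrite normE_conj.
have [p eP] : exists p, 1 + eD a / eD b = eD p.
  by rewrite eDV // eDM eD1 eDD; eexists.
have eS : eD p * eD b = eD (addE a b).
  by rewrite -eP mulrDl mul1r -mulrA mulVr ?eD_unit // mulr1 addrC eDD addEC.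
have [r eR] : exists r, 1 + qconj (eD a) / qconj (eD b) = eD r.
  by rewrite !eD_conj eDV // eDM eD1 eDD; eexists.
have eT : eD r * eD (conjE b) = eD (conjE (addE a b)).
  rewrite -eR !eD_conj mulrDl mul1r -mulrA mulVr ?eD_unit // mulr1 addrC eDD.
  by congr eD; rewrite /addE /conjE /= opprD.
have r0 : eD r \is a GRing.unit.
  have := eD_unit cs0; rewrite -eT unitrM_comm; last exact: eD_comm.
  by case/andP.
have cV : (eD r)^-1 * eD b = eD b * (eD r)^-1.
  by apply/esym/commrV/eD_comm.
rewrite eP eR -mulrA cV mulrA eS; apply: (mulIr r0); rewrite divrK //.
rewrite eD_comm /turnE -!eDM mulrA eT mulrA [eD _ * eD (addE a b)]eD_comm.
by rewrite -mulrA -(eDV cs0) divrr ?eD_unit // mulr1.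
Qed.
End Embedding.

(** * Presentation *)

Section PresentedWords.
Variables (X : Type) (R : word X -> word X -> Prop).

Lemma weval_cat (G : groupType) (f : X -> G) u v :
  weval f (u ++ v) = (weval f u * weval f v)%g.
Proof. exact: big_cat. Qed.

Lemma weval_pres (G : groupType) (f : X -> G) u v :
  (forall u v, R u v -> weval f u = weval f v) -> pres_eq R u v -> weval f u = weval f v.
Proof.
move=> fR; elim=> //.
- by move=> ? ? ? _ -> _ ->.
- by move=> ? ? ? ? _ e _ e'; rewrite !weval_cat e e'.
- by move=> x [] /=; rewrite /weval !big_cons big_nil /= mulg1 ?mulgV ?mulVg.
Qed.

Lemma pres_catl u v v' : pres_eq R v v' -> pres_eq R (u ++ v) (u ++ v').
Proof. by move=> e; apply: PresCat => //; apply: PresRefl. Qed.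

Lemma pres_catr u u' v : pres_eq R u u' -> pres_eq R (u ++ v) (u' ++ v).
Proof. by move=> e; apply: PresCat => //; apply: PresRefl. Qed.
End PresentedWords.

Lemma nsorted_split (T : Type) (e : rel T) s : ~~ sorted e s ->
  exists u x y v, s = u ++ x :: y :: v /\ ~~ e x y.
Proof.
elim: s => // x [|y s] //= IH; case exy: (e x y) => /=.
  by move=> /IH [u [x' [y' [v [-> ?]]]]]; exists (x :: u), x', y', v.
by move=> _; exists [::], x, y, s; rewrite exy.
Qed.

(** * Products of letters modulo t - tau *)

Section LocalWords.
Variables (F : finFieldType) (c : F).
Hypothesis c_nonsquare : forall x : F, x ^+ 2 != c.
Local Notation A := (quat c%:P 'X).
Implicit Types a b : F * F.

Definition Pq (s : seq (F * F)) : A := \prod_(a <- s) op c a.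

Lemma Pq_cat s1 s2 : Pq (s1 ++ s2) = Pq s1 * Pq s2.
Proof. exact: big_cat. Qed.

Lemma Pq_cons a s : Pq (a :: s) = op c a * Pq s.
Proof. exact: big_cons. Qed.

Lemma nrd_op a : nrd (op c a) = 1 - normE c a *: 'X.
Proof.
rewrite nrd_split -mul_polyC /= polyCN sqrrN expr0n mulr0 subr0 expr1n.
rewrite /normE polyCB polyC_exp polyCM polyC_exp; ring.
Qed.

Lemma Pq_one_mod_F s : one_mod_F (Pq s).
Proof.
elim: s => [|a s IH]; first by rewrite /Pq big_nil; split; rewrite /= hornerC.
by rewrite Pq_cons; apply: one_mod_FM => //; split; rewrite /= hornerC.
Qed.

Variable tau : F.

Definition ev (P : A) : quat c tau :=
  Quat (q1 P).[tau] (qz P).[tau] (qf P).[tau] (qfz P).[tau].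

Lemma evM P Q : ev (P * Q) = ev P * ev Q.
Proof.
by congr Quat; rewrite /= !(hornerD, hornerN, hornerM, hornerC, hornerX); ring.
Qed.

Lemma nrd_ev P : nrd (ev P) = (nrd P).[tau].
Proof.
by rewrite /nrd /= !(hornerD, hornerN, hornerM, hornerC, hornerX, horner_exp).
Qed.

Lemma ev_op a : ev (op c a) = Quat 1 0 a.1 (- a.2).
Proof. by congr Quat; rewrite /= hornerC. Qed.

Lemma nrd_ev_Pq_neq0 s :
  all (fun a => normE c a * tau != 1) s -> nrd (ev (Pq s)) != 0.
Proof.
elim: s => [_|a s IH /= /andP[ha /IH {}IH]].
  by rewrite nrd_ev /Pq big_nil nrd1 hornerC oner_neq0.
rewrite Pq_cons evM nrdM mulf_neq0 // nrd_ev nrd_op.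
by rewrite !(hornerD, hornerN, hornerZ, hornerC, hornerX) subr_eq0 eq_sym.
Qed.

(* Modulo [t - tau] one has (1 + aF)(1 + bF) = (1 + aF)g with
   g = 1 + a (conj b) tau in F_q[Z], and g = 0 only if b = - a. *)
Lemma ev_Pq_reduced a s :
  all (fun b => normE c b * tau == 1) (a :: s) ->
  path (fun a b => b != oppE a) a s ->
  exists2 g, normE c g != 0 & ev (Pq (a :: s)) = ev (op c a) * Quat g.1 g.2 0 0.
Proof.
elim: s a => [|b s IH] a /=.
  move=> _ _; exists (1, 0); first by rewrite /normE /=
    expr0n mulr0 subr0 expr1n oner_neq0.
  by rewrite Pq_cons evM /Pq big_nil; congr (_ * _); congr Quat; rewrite /= hornerC.
move=> /andP[/eqP na /andP[/eqP nb ns]] /andP[ba pbs].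
have [||g g0 eg] := IH b => //; first by rewrite /= nb eqxx.
pose h := addE (1, 0) (mulE c (tau, 0) (mulE c a (conjE b))).
exists (mulE c h g).
  rewrite normEM mulf_neq0 //; apply: contra_neq ba => /(normE_eq0 c_nonsquare) h0.
  (* As [N(b) tau = 1], the product [h b] is [b + a]. *)
  have : mulE c h b = addE b (mulE c ((normE c b) * tau, 0) a).
    by congr pair; rewrite /normE /=; ring.
  rewrite h0 nb /mulE /addE; case: b a {IH eg h pbs h0 na nb} => [x y] [z w] /=.
  rewrite !(mul0r, mulr0, mul1r, addr0) => -[/esym/eqP + /esym/eqP].
  by rewrite !addr_eq0 => /eqP -> /eqP ->.
rewrite Pq_cons evM eg mulrA !ev_op; move: na; rewrite /normE => na.
congr Quat => /=; rewrite ?(mul0r, mulr0, mul1r, mulr1, addr0, add0r, subr0, sub0r).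
- by ring.
- by ring.
(* A factor [N(a) tau = 1] is inserted, after which both sides agree as polynomials. *)
- transitivity (a.1 * g.1 - c * (a.2 * g.2) + (b.1 * g.1 - c * (b.2 * g.2)) *
    ((a.1 ^+ 2 - c * a.2 ^+ 2) * tau)); first by rewrite na; ring.
  by ring.
- transitivity (a.1 * g.2 - a.2 * g.1 + (b.1 * g.2 - b.2 * g.1) *
    ((a.1 ^+ 2 - c * a.2 ^+ 2) * tau)); first by rewrite na; ring.
  by ring.
Qed.

Lemma reduced_not_scalar a s1 s2 r :
  all (fun b => normE c b * tau == 1) (a :: s1) ->
  all (fun b => normE c b * tau != 1) s2 ->
  path (fun a b => b != oppE a) a s1 -> Pq ((a :: s1) ++ s2) <> r%:A.
Proof.
move=> h1 h2 /(ev_Pq_reduced h1) [g g0 eg] /(congr1 ev).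
rewrite Pq_cat evM => e.
have ev_scalar : ev r%:A = (r.[tau])%:A.
  by rewrite !quat_scalarE; congr Quat; rewrite /= horner0.
have na : nrd (ev (op c a)) = 0.
  rewrite nrd_ev nrd_op !(hornerD, hornerN, hornerZ, hornerC, hornerX).
  by move: h1 => /= /andP[/eqP -> _]; rewrite subrr.
have r0 : r.[tau] = 0.
  have /eqP := congr1 (@nrd _ _ _) e.
  rewrite ev_scalar eg !nrdM na !mul0r nrd_scalar eq_sym expf_eq0 /=.
  by move/eqP.
move: e; rewrite ev_scalar r0 scale0r => /quat_mul_eq0l.
move=> /(_ (nrd_ev_Pq_neq0 h2)); rewrite eg ev_op => e.
(* The coordinates of (1 + aF)g at 1 and Z are those of [g]. *)
move/eqP: g0; apply; have := congr1 (@q1 _ _ _) e; have := congr1 (@qz _ _ _) e => /=.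
rewrite ?(mul0r, mulr0, mul1r, mulr1, addr0, add0r, subr0, sub0r) => e2 e1.
by rewrite /normE e1 e2 expr0n /= mulr0 subrr.
Qed.
End LocalWords.

(** * Words compared with polynomial quaternions *)

Section Presentation.
Variables (F : finFieldType) (K : ratfun F) (S : rplaces F) (c : F).
Hypothesis c_nonsquare : forall x : F, x ^+ 2 != c.
Local Notation A := (quat c%:P 'X).
Local Notation Lam := (Lambda K S c).
Local Notation gens := (gens K S c).
Local Notation X := (set_type gens).
Local Notation "u ~ v" := (pres_eq (square_rel K S c) u v) (at level 70).

(** A relation and not a function, since a class has several polynomial lifts, which differ by
    scalars. *)
Definition represents (g : Lam) (P : A) :=
  exists2 w : agroup K S c, g = (\pi_(Lam) w)%qT & agval w = qK K P.

Lemma represents1 : represents 1%g 1.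
Proof. by exists (ag1 K S c); rewrite // /qK qmap1. Qed.

Lemma representsM g h P Q :
  represents g P -> represents h Q -> represents (g * h)%g (P * Q).
Proof.
move=> [v -> ev] [w -> ew]; exists (agM v w); first exact: lamM_pi.
by rewrite /qK qmapM /= ev ew.
Qed.

Lemma representsX g P n : represents g P -> represents (g ^+ n)%g (P ^+ n).
Proof.
move=> gP; elim: n => [|n IH]; first exact: represents1.
by rewrite expgS exprS; apply: representsM.
Qed.

Lemma represents_inj g h P : represents g P -> represents h P -> g = h.
Proof.
move=> [v -> ev] [w -> ew]; congr ((\pi_(Lam) _)%qT).
by apply: val_inj; rewrite /= ev ew.
Qed.

(** If [P] is a scalar, so are the lift [w] and its inverse; both lie in A(o_S), which makes the
    scalar an S-unit. *)
Lemma represents_eq1 g P : represents g P -> g = 1%g <-> P = (q1 P)%:A.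
Proof.
case=> w -> ew; split.
  move=> /esym/eqP/pi_eqP [u _] eu; have {}eu : qK K P = u%:A by rewrite -ew eu.
  have fr0 p : fr K p = u * 0 -> p = 0.
    by rewrite mulr0 -(rmorph0 (fr K)) => /fr_inj.
  case: P eu {ew} => x y z t [_ /fr0 -> /fr0 -> /fr0 ->].
  by rewrite quat_scalarE.
move=> eP; set u := fr K (q1 P).
have ewu : agval w = u%:A.
  by rewrite ew eP quat_scalarE [RHS]quat_scalarE; congr Quat; rewrite /= rmorph0.
have u0 : u != 0.
  have := ag_unit w; rewrite ewu; apply: contraTneq => ->.
  by rewrite scale0r unitr0.
have ewV : agval (agV w) = (u^-1)%:A.
  apply: (mulrI (ag_unit w)); rewrite divrr ?ag_unit // ewu.
  by rewrite -scalerAl mul1r scalerA divff // scale1r.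
apply/esym/eqP/pi_eqP; exists u => //; split=> //.
- by move: (agvalP w) => /asboolP [[+ _ _ _] _ _]; rewrite ewu quat_scalarE.
by move: (agvalP (agV w)) => /asboolP [[+ _ _ _] _ _]; rewrite ewV quat_scalarE.
Qed.

Lemma represents_opF a :
  (normE c a)^-1 \in finplaces S -> represents (opF S (eD K c a)) (op c a).
Proof.
move=> aS; have na : FqZ_norm (normE c a)^-1^-1 (eD K c a).
  by apply/FqZ_normP; exists a; rewrite ?invrK.
have u := opF_unit aS na; exists (AGroup u); last by rewrite qK_op.
by rewrite /opF /cls; congr (\pi_(Lam) _)%qT; apply: (valKd _ (AGroup u)).
Qed.

(** The place of a letter is recovered as the inverse of its norm, so letters need not carry it. *)
Definition letter := {a : F * F | (normE c a)^-1 \in finplaces S}.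
Definition mk_letter (x : F * F) (xS : (normE c x)^-1 \in finplaces S) : letter :=
  exist _ x xS.
Implicit Types (a b : letter) (s : seq letter).

Lemma letter_gens a : opF S (eD K c (val a)) \in gens.
Proof.
apply/mem_set; exists (normE c (val a))^-1; first exact: (valP a).
exists (eD K c (val a)) => //; apply/FqZ_normP; exists (val a) => //.
by rewrite invrK.
Qed.

Definition gen a : X := SigSub (letter_gens a).

Lemma gen_surj (x : X) : exists a, x = gen a.
Proof.
case: (set_mem (valP x)) => t tS [al /FqZ_normP [a na ->] e].
have aS : (normE c a)^-1 \in finplaces S by rewrite na invrK.
by exists (mk_letter aS); apply: val_inj; rewrite -e.
Qed.

Lemma normE_neq0 a : normE c (val a) != 0.
Proof. by have := valP a; rewrite inE invr_eq0 => /andP[]. Qed.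

Definition wordP s : word X := [seq (gen a, true) | a <- s].
Definition polyP s : A := Pq c (map val s).

Lemma wordP_cat s1 s2 : wordP (s1 ++ s2) = wordP s1 ++ wordP s2.
Proof. exact: map_cat. Qed.

Lemma polyP_cat s1 s2 : polyP (s1 ++ s2) = polyP s1 * polyP s2.
Proof. by rewrite /polyP map_cat Pq_cat. Qed.

Lemma represents_wordP s : represents (weval val (wordP s)) (polyP s).
Proof.
elim: s => [|a s IH]; first by rewrite /weval /polyP /Pq !big_nil; apply: represents1.
rewrite /weval big_cons /polyP /= Pq_cons; apply: representsM => //=.
exact/represents_opF/(valP a).
Qed.

(** The square relations hold exactly between polynomial quaternions, the inverse relations up to
    the scalar [1 - N(a) t]. *)
Lemma square_rel_sound u v :
  square_rel K S c u v -> weval val u = weval val v.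
Proof.
have rep t al (x : X) : t \in finplaces S -> FqZ_norm t^-1 al -> val x = opF S al ->
    exists2 a, normE c a = t^-1 & al = eD K c a /\ represents (val x) (op c a).
  move=> tS /FqZ_normP [a na ->] ->; exists a => //; split=> //.
  by apply: represents_opF; rewrite na invrK.
case.
  move=> t al x y tS nal ex ey; have [a na [eal rx]] := rep _ _ _ tS nal ex.
  have [b nb [eb ry]] := rep _ _ _ tS (FqZ_normN nal) ey.
  rewrite /weval !big_cons !big_nil /= mulg1.
  apply/(represents_eq1 (representsM rx ry)).
  have -> : b = oppE a.
    move: eb; rewrite eal; case: b a {ry rx nb na eal} => [b1 b2] [a1 a2].
    by case; rewrite /= -!cstN => /cst_inj <- /cst_inj <-.
  by rewrite op_inv !quat_scalarE.
move=> t s al be x y z w tS sS ts nal nbe ex ey ez ew.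
have [a na [eal rx]] := rep _ _ _ tS nal ex.
have [b nb [ebe ry]] := rep _ _ _ sS nbe ey.
have nab : normE c a != normE c b by rewrite na nb (inj_eq invr_inj); apply/eqP.
have nba : normE c b != normE c a by rewrite eq_sym.
have t0 : t^-1 != 0 by rewrite invr_eq0; move: tS; rewrite inE => /andP[].
have s0 : s^-1 != 0 by rewrite invr_eq0; move: sS; rewrite inE => /andP[].
have a0 : normE c a != 0 by rewrite na.
have b0 : normE c b != 0 by rewrite nb.
rewrite /weval !big_cons !big_nil /= !mulg1.
apply: (represents_inj (representsM rx ry)); rewrite op_square //.
rewrite ez ew eal ebe !zeta_turn //.
by apply: representsM; apply: represents_opF; rewrite normE_turn // ?na ?nb invrK.
Qed.

(** Rewriting by squares only: besides derivability, the exact product and the length are kept, as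
    the induction on the length in [scalar_wordP] requires. *)
Definition equiv s s' :=
  [/\ wordP s ~ wordP s', polyP s = polyP s' & size s = size s'].

Lemma equiv_refl s : equiv s s.
Proof. by split=> //; apply: PresRefl. Qed.

Lemma equiv_trans s2 s1 s3 : equiv s1 s2 -> equiv s2 s3 -> equiv s1 s3.
Proof.
move=> [e1 p1 z1] [e2 p2 z2]; split; rewrite ?p1 ?z1 //.
exact: PresTrans e1 e2.
Qed.

Lemma equiv_cat s1 s2 s1' s2' :
  equiv s1 s1' -> equiv s2 s2' -> equiv (s1 ++ s2) (s1' ++ s2').
Proof.
move=> [e1 p1 z1] [e2 p2 z2]; split; rewrite ?size_cat ?z1 ?z2 //.
  by rewrite !wordP_cat; apply: PresCat.
by rewrite !polyP_cat p1 p2.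
Qed.

Local Notation nm a := (normE c (val a)).

Lemma equiv_swap a b : nm a != nm b ->
  exists b' a', [/\ nm b' = nm b, nm a' = nm a & equiv [:: a; b] [:: b'; a']].
Proof.
move=> nab; have nba : nm b != nm a by rewrite eq_sym.
have e1 := normE_turn c_nonsquare nab; have e2 := normE_turn c_nonsquare nba.
have bS : (normE c (turnE c (val a) (val b)))^-1 \in finplaces S by rewrite e1 (valP b).
have aS : (normE c (turnE c (val b) (val a)))^-1 \in finplaces S by rewrite e2 (valP a).
exists (mk_letter bS), (mk_letter aS); split=> //; split=> //; last first.
  by rewrite /polyP /= !Pq_cons /Pq big_nil !mulr1 op_square.
apply/PresRel/(@RelSquare _ _ _ _ (nm a)^-1 (nm b)^-1 (eD K c (val a)) (eD K c (val b))).
- exact: (valP a).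
- exact: (valP b).
- by move=> /invr_inj/eqP; rewrite (negbTE nab).
- by apply/FqZ_normP; exists (val a); rewrite ?invrK.
- by apply/FqZ_normP; exists (val b); rewrite ?invrK.
- by [].
- by [].
- by rewrite zeta_turn ?normE_neq0.
- by rewrite zeta_turn ?normE_neq0.
Qed.

(** A swap changes the letters but not their norms, so the moving letter stays different in norm
    from the block it crosses. *)
Lemma equiv_push n s a : nm a != n -> all (fun b => nm b == n) s ->
  exists s' a', [/\ all (fun b => nm b == n) s', nm a' = nm a
    & equiv (a :: s) (rcons s' a')].
Proof.
elim: s a => [|b s IH] a an /=.
  by move=> _; exists [::], a; split=> //; apply: equiv_refl.
move=> /andP[/eqP bn sn]; have nab : nm a != nm b by rewrite bn.
have [b' [a1 [nb' na1 e]]] := equiv_swap nab.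
have [//|s' [a' [ns' na' e']]] := IH a1 _ sn; first by rewrite na1.
exists (b' :: s'), a'; split; rewrite ?na' //=; first by rewrite nb' bn eqxx.
apply: equiv_trans (_ : equiv [:: b', a1 & s] _).
  exact: (equiv_cat e (equiv_refl s)).
exact: (equiv_cat (equiv_refl [:: b']) e').
Qed.

Lemma equiv_gather n s : exists s1 s2, [/\ all (fun b => nm b == n) s1,
  all (fun b => nm b != n) s2 & equiv s (s1 ++ s2)].
Proof.
elim: s => [|a s [s1 [s2 [h1 h2 e]]]].
  by exists [::], [::]; split=> //; apply: equiv_refl.
have e' := equiv_cat (equiv_refl [:: a]) e.
have [an|an] := eqVneq (nm a) n.
  by exists (a :: s1), s2; split=> //=; rewrite an eqxx.
have [s' [a' [ns' na' e1]]] := equiv_push an h1.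
exists s', (a' :: s2); split=> //=; first by rewrite na' an.
apply: equiv_trans e' _; rewrite -cat_rcons.
exact: (equiv_cat e1 (equiv_refl s2)).
Qed.

Lemma wordP_cancel a b : val b = oppE (val a) -> wordP [:: a; b] ~ [::].
Proof.
move=> ba; apply/PresRel/(@RelInv _ _ _ _ (nm a)^-1 (eD K c (val a))).
- exact: (valP a).
- by apply/FqZ_normP; exists (val a); rewrite ?invrK.
- by [].
- by rewrite /= ba; congr (opF _ _); congr Quat; rewrite /= ?cstN ?oppr0.
Qed.

Lemma polyP_unit s : nrd (polyP s) != 0.
Proof.
have [P1 P2] := Pq_one_mod_F c (map val s).
have e : (nrd (polyP s)).[0] = 1.
  rewrite nrd_split !(hornerD, hornerN, hornerM, hornerX, hornerC, horner_exp) P1 P2.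
  by ring.
by apply: contra_eq_neq e => ->; rewrite horner0 eq_sym oner_neq0.
Qed.

Lemma scalar_wordP s r : polyP s = r%:A -> wordP s ~ [::].
Proof.
move: {2}(size s) (leqnn (size s)) => m; elim: m s r => [|m IH] s r.
  by case: s => // _ _; apply: PresRefl.
case: s => [_ _|a s sm er]; first exact: PresRefl.
have [s1 [s2 [h1 h2 [e ep es]]]] := equiv_gather (nm a) s.
rewrite -cat1s wordP_cat; apply: PresTrans (pres_catl _ e) _; rewrite -!wordP_cat.
have {}er : polyP ([:: a] ++ s1 ++ s2) = r%:A by rewrite polyP_cat -ep -polyP_cat.
(* The place is the inverse of the norm of the first letter, so letters at this place are those with
   the same norm. *)
have tau (z : F * F) : (normE c z * (nm a)^-1 == 1) = (normE c z == nm a).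
  by rewrite -subr_eq0 -{1}(divff (normE_neq0 a)) -mulrBl mulf_eq0 invr_eq0
    (negbTE (normE_neq0 a)) orbF subr_eq0.
(* A reduced front block is impossible for a scalar product; otherwise two adjacent letters of the
   block are opposite and cancel. *)
have [red|/nsorted_split] := boolP (sorted (fun a b => val b != oppE (val a)) (a :: s1)).
  case: (@reduced_not_scalar _ _ c_nonsquare (nm a)^-1
    (val a) (map val s1) (map val s2) r).
  - by rewrite /= tau eqxx /= all_map; apply: sub_all h1 => b /=; rewrite tau.
  - by rewrite all_map; apply: sub_all h2 => b /=; rewrite tau.
  - by rewrite path_map.
  - by rewrite -er /polyP /= map_cat.
move=> [u [x [y [v [e1]]]]]; rewrite negbK => /eqP yx.
have euv : [:: a] ++ s1 ++ s2 = u ++ [:: x; y] ++ (v ++ s2).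
  by rewrite catA -[[:: a] ++ s1]/(a :: s1) e1 -catA.
have suv : (size (u ++ (v ++ s2)) <= m)%N.
  move: sm; rewrite /= es -[size _]/(size ([:: a] ++ s1 ++ s2)).-1 euv.
  by rewrite !size_cat /=; lia.
rewrite euv !wordP_cat.
apply: PresTrans (pres_catl _ (pres_catr _ (wordP_cancel yx))) _.
rewrite cat0s -!wordP_cat; apply: (IH _ (q1 (polyP (u ++ v ++ s2)))) => //.
have : polyP (u ++ [:: x; y] ++ (v ++ s2)) = r%:A by rewrite -euv.
rewrite !polyP_cat; have -> : polyP [:: x; y] = (1 - nm x *: 'X)%:A.
  by rewrite /polyP /= !Pq_cons /Pq big_nil mulr1 yx op_inv.
(* Dropping the pair divides the product by the scalar [l]. Its constant term is 1, so [l] is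
   nonzero and the shorter product is again a scalar. *)
set l := 1 - _; rewrite -scalerAl mul1r -scalerAr -polyP_cat => eP.
have l0 : l != 0.
  apply/eqP => /(congr1 (horner^~ 0)) /eqP.
  by rewrite !(hornerD, hornerN, hornerZ, hornerC, hornerX) mulr0 subr0 oner_eq0.
move: eP; rewrite -polyP_cat; case: (polyP _) => p1 p2 p3 p4; rewrite !quat_scalarE.
move=> [_ /eqP + /eqP + /eqP]; rewrite !mulf_eq0 (negbTE l0) /=.
by move=> /eqP-> /eqP-> /eqP->.
Qed.

Lemma opp_letterP a : (normE c (oppE (val a)))^-1 \in finplaces S.
Proof. by rewrite normE_opp (valP a). Qed.

Definition opp_letter a : letter := mk_letter (opp_letterP a).

Lemma wordP_inv s : exists t, wordP s ++ wordP t ~ [::] /\ wordP t ++ wordP s ~ [::].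
Proof.
elim: s => [|a s [t [e1 e2]]]; first by exists [::]; split; apply: PresRefl.
have c1 : wordP [:: a; opp_letter a] ~ [::] by apply: wordP_cancel.
have c2 : wordP [:: opp_letter a; a] ~ [::] by apply: wordP_cancel; rewrite oppEK.
exists (t ++ [:: opp_letter a]); rewrite -[a :: s]/([:: a] ++ s) !wordP_cat -!catA.
split.
  apply: PresTrans c1; apply: (pres_catl (wordP [:: a])).
  by rewrite catA; apply: (pres_catr (wordP [:: opp_letter a]) e1).
apply: PresTrans e2; apply: (pres_catl (wordP t)).
exact: (pres_catr (wordP s) c2).
Qed.

(** The inverse relation replaces the inverse of a letter by the opposite letter. *)
Lemma word_positive (u : word X) : exists s, u ~ wordP s.
Proof.
elim: u => [|[x b] u [s es]]; first by exists [::]; apply: PresRefl.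
have [a ->] := gen_surj x; case: b.
  by exists (a :: s); apply: (pres_catl [:: (gen a, true)] es).
exists (opp_letter a :: s).
apply: (@PresTrans _ _ _ ([:: (gen a, false)] ++ wordP [:: a; opp_letter a] ++ wordP s)).
  apply: (pres_catl [:: (gen a, false)]); apply: PresTrans es _; apply: PresSym.
  by apply: (pres_catr _ (wordP_cancel _)).
exact: (pres_catr (wordP (opp_letter a :: s)) (PresCancel _ (gen a) false)).
Qed.

Lemma weval_range : range (weval (fun x : X => val x)) = Gamma K S c.
Proof.
have sound := weval_pres square_rel_sound.
apply/seteqP; split.
  move=> _ [u _ <-] H H1 HM HV genH; elim: u => [|[x b] u IH].
    by rewrite /weval big_nil.
  rewrite /weval big_cons; apply: HM => //=.
  have Hx := genH _ (set_mem (valP x)).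
  by case: b => //; apply: HV.
move=> g; apply.
- by exists [::] => //; rewrite /weval big_nil.
- by move=> _ _ [u _ <-] [v _ <-]; exists (u ++ v); rewrite ?weval_cat.
- move=> _ [u _ <-]; have [s /sound ->] := word_positive u.
  have [t [/sound + _]] := wordP_inv s; rewrite weval_cat [in X in _ = X]/weval big_nil.
  by move=> /mulg1_eq e; exists (wordP t); rewrite ?e.
- move=> x xg; exists [:: (SigSub (mem_set xg) : X, true)] => //.
  by rewrite /weval big_cons big_nil mulg1.
Qed.

Lemma Gamma_presentation :
  has_presentation (Gamma K S c) (fun x : X => val x) (square_rel K S c).
Proof.
have sound := weval_pres square_rel_sound.
split=> [|u v]; [exact: weval_range | split=> [uv|]; last exact: sound].
have [s es] := word_positive u; have [s' es'] := word_positive v.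
have [t [st ts]] := wordP_inv s'.
(* The positive word [s ++ t] spells u v^-1. *)
have e1 : weval val (wordP (s ++ t)) = 1%g.
  rewrite wordP_cat weval_cat -(sound _ _ es) uv (sound _ _ es') -weval_cat.
  by rewrite (sound _ _ st) /weval big_nil.
have /scalar_wordP := (represents_eq1 (represents_wordP (s ++ t))).1 e1.
rewrite wordP_cat => st1.
apply: PresTrans es _; apply: PresTrans _ (PresSym es').
apply: (@PresTrans _ _ _ (wordP s ++ wordP t ++ wordP s')).
  by rewrite -{1}[wordP s]cats0; apply/pres_catl/PresSym.
by rewrite catA; apply: (pres_catr (wordP s') st1).
Qed.

Lemma Gamma_represents g : Gamma K S c g -> exists s, represents g (polyP s).
Proof.
rewrite -weval_range => -[u _ <-]; have [s es] := word_positive u.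
exists s; rewrite (weval_pres square_rel_sound es); exact: represents_wordP.
Qed.

Lemma Gamma_torsion_free g n :
  Gamma K S c g -> (0 < n)%N -> (g ^+ n)%g = 1%g -> g = 1%g.
Proof.
move=> /Gamma_represents [s gs] n0 gn; apply/(represents_eq1 gs).
apply: self_conj_scalar.
  by rewrite -polyC_natr polyC_eq0 (nonsquare_two_neq0 c_nonsquare).
apply: (one_mod_F_torsion c_nonsquare (Pq_one_mod_F _ _) n0).
exact: (represents_eq1 (representsX n gs)).1.
Qed.
End Presentation.

(** * Cell stabilisers *)

Section Valuation.
Variables (L : fieldType) (v : L -> int).
Hypothesis vM : forall a b, a != 0 -> b != 0 -> v (a * b) = v a + v b.
Hypothesis vD : forall n a b, val_ge v n a -> val_ge v n b -> val_ge v n (a + b).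
Local Notation vge := (val_ge v).

Lemma val1 : v 1 = 0.
Proof. by apply: (@addrI _ (v 1)); rewrite addr0 -vM ?oner_neq0 ?mulr1. Qed.

Lemma valX a n : a != 0 -> v (a ^+ n) = v a *+ n.
Proof.
move=> a0; elim: n => [|n IH]; first by rewrite val1.
by rewrite exprS vM ?expf_neq0 // IH mulrS.
Qed.

Lemma val_ge_val a : vge (v a) a.
Proof. by right. Qed.

Lemma val_geW m n a : m <= n -> vge n a -> vge m a.
Proof. by move=> mn [->|na]; [left | right; apply: le_trans na]. Qed.

Lemma val_geM m n a b : vge m a -> vge n b -> vge (m + n) (a * b).
Proof.
have [->|a0] := eqVneq a 0; first by left; rewrite mul0r.
have [->|b0] := eqVneq b 0; first by left; rewrite mulr0.
move=> [/eqP|ma]; first by rewrite (negbTE a0).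
move=> [/eqP|nb]; first by rewrite (negbTE b0).
by right; rewrite vM // lerD.
Qed.

Lemma val_ge_sum (I : finType) n (f : I -> L) :
  (forall i, vge n (f i)) -> vge n (\sum_i f i).
Proof. by move=> nf; apply: big_ind => //; [left | move=> *; apply: vD]. Qed.

Lemma val_ge_bound (I : finType) (f : I -> L) :
  exists B : nat, forall i, vge (- B%:Z) (f i).
Proof.
exists (\max_i `|v (f i)|)%N => i; apply: (val_geW _ (val_ge_val _)).
have := leq_bigmax (F := fun i => `|v (f i)|%N) i; lia.
Qed.

Definition integral_mx m n (U : 'M[L]_(m, n)) := forall i j, vge 0 (U i j).

Lemma val_ge_mulmx m n p e e' (U : 'M[L]_(m, n)) (W : 'M[L]_(n, p)) :
  (forall i j, vge e (U i j)) -> (forall i j, vge e' (W i j)) ->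
  forall i j, vge (e + e') ((U *m W) i j).
Proof. by move=> hU hW i j; rewrite mxE; apply: val_ge_sum => k; apply: val_geM. Qed.

Lemma integral_mxX n (U : 'M[L]_n.+1) e : integral_mx U -> integral_mx (U ^+ e).
Proof.
move=> iU; elim: e => [|e IH] i j.
  rewrite expr0 mxE; case: eqP => _; last by left.
  by right; rewrite val1.
by rewrite exprS -[0]addr0; apply: val_ge_mulmx.
Qed.

Section Coordinates.
Variables (a b : L).
Implicit Types y z : quat a b.

Definition coord_ge n y := [/\ vge n (q1 y), vge n (qz y), vge n (qf y) & vge n (qfz y)].

Lemma coord_geD n y z : coord_ge n y -> coord_ge n z -> coord_ge n (y + z).
Proof. by case=> ? ? ? ? [? ? ? ?]; split; apply: vD. Qed.

Lemma coord_geZ m n r y : vge m r -> coord_ge n y -> coord_ge (m + n) (r *: y).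
Proof. by move=> mr [? ? ? ?]; split; apply: val_geM. Qed.

Lemma coord_ge_bound (I : finType) (f : I -> quat a b) :
  exists B : nat, forall i, coord_ge (- B%:Z) (f i).
Proof.
have [B1 h1] := val_ge_bound (fun i => q1 (f i)).
have [B2 h2] := val_ge_bound (fun i => qz (f i)).
have [B3 h3] := val_ge_bound (fun i => qf (f i)).
have [B4 h4] := val_ge_bound (fun i => qfz (f i)).
exists (B1 + B2 + B3 + B4)%N => i.
by split; [apply: val_geW (h1 i) | apply: val_geW (h2 i)
  | apply: val_geW (h3 i) | apply: val_geW (h4 i)]; lia.
Qed.

(** The image of [y ^+ n] is [d^n h U^n h^-1] with [U^n] integral. Multiplication by [h] and by its
    inverse, and the passage from matrix units back to quaternions, each lose a bounded amount
    independent of [n]. *)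
Lemma coord_ge_exp (phi : {lrmorphism quat a b -> 'M[L]_2}) (h U : 'M[L]_2) (d : L) y :
  bijective phi -> h \in unitmx -> integral_mx U -> d != 0 ->
  phi y = d *: (h *m U *m invmx h) ->
  exists B : nat, forall n : nat, coord_ge (n%:Z * v d - B%:Z) (y ^+ n).
Proof.
case=> psi phiK psiK uh iU d0 ey.
have [B1 hB1] := val_ge_bound (fun p => h p.1 p.2).
have [B2 hB2] := val_ge_bound (fun p => invmx h p.1 p.2).
have [B3 hB3] := coord_ge_bound (fun p => psi (delta_mx p.1 p.2)).
exists (B1 + B2 + B3)%N => n; pose W := h *m U ^+ n *m invmx h.
have eW : phi (y ^+ n) = d ^+ n *: W.
  have -> : phi (y ^+ n) = phi y ^+ n by apply: rmorphXn.
  rewrite ey /W; elim: n {W} => [|n IH].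
    by rewrite !expr0 scale1r mulmx1 mulmxV.
  rewrite !exprS IH -[_ * _]/(_ *m _) -scalemxAl -scalemxAr scalerA; congr (_ *: _).
  by rewrite -!mulmxA (mulmxA (invmx h) h) mulVmx // mul1mx.
have -> : y ^+ n = d ^+ n *: \sum_i \sum_j W i j *: psi (delta_mx i j).
  apply: (can_inj phiK); rewrite eW linearZ /=; congr (_ *: _).
  rewrite {1}[W]matrix_sum_delta linear_sum; apply: eq_bigr => i _.
  by rewrite linear_sum; apply: eq_bigr => j _; rewrite linearZ /= psiK.
have -> : n%:Z * v d - (B1 + B2 + B3)%N%:Z =
    n%:Z * v d + ((- B1%:Z + 0 - B2%:Z) - B3%:Z) by lia.
apply: coord_geZ.
  by right; rewrite valX // -mulr_natl natz.
have coord_ge0 m : coord_ge m 0 by split; left.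
apply: (big_ind (coord_ge _)) => [//||i _]; first by move=> *; apply: coord_geD.
apply: (big_ind (coord_ge _)) => [//||j _]; first by move=> *; apply: coord_geD.
apply: coord_geZ; last exact: (hB3 (i, j)).
apply: val_ge_mulmx => [k l|k l]; last exact: (hB2 (k, l)).
apply: val_ge_mulmx => [k' l'|k' l']; first exact: (hB1 (k', l')).
exact: integral_mxX.
Qed.
End Coordinates.

(** For [M = h O^2], with O the valuation ring, [A] maps [M] onto some [d M], so [U = d^-1 h^-1 A h]
    maps O^2 onto itself. The columns of [U] are images of the basis vectors, those of [U'] are
    preimages. *)
Lemma lattice_stab (M : set 'cV[L]_2) (A : 'M[L]_2) : lattice v M ->
  mact A (homothety_class M) = homothety_class M ->
  exists h U U' (d : L), [/\ h \in unitmx, integral_mx U, integral_mx U', U *m U' = 1%:M &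
    d != 0 /\ A = d *: (h *m U *m invmx h)].
Proof.
move=> [h uh eM] fixA.
have [d d0 eA] : homothety_class M [set A *m u | u in M].
  rewrite -fixA; exists M => //; exists 1; first exact: oner_neq0.
  by rewrite -[LHS]image_id; apply: eq_imagel => u _; rewrite scale1r.
have int_delta j : [set u : 'cV[L]_2 | forall i, vge 0 (u i ord0)] (delta_mx j ord0).
  by move=> i; rewrite mxE; case: (_ && _); [right; rewrite val1 | left].
pose U := d^-1 *: (invmx h *m A *m h).
have eU : A = d *: (h *m U *m invmx h).
  rewrite /U -scalemxAr -scalemxAl scalerA divff // scale1r.
  by rewrite !mulmxA mulmxV // mul1mx -mulmxA mulmxV // mulmx1.
have hU u : A *m (h *m u) = d *: (h *m (U *m u)).
  by rewrite {1}eU -scalemxAl -!mulmxA (mulmxA (invmx h) h) mulVmx // mul1mx.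
have h_inj (u w : 'cV[L]_2) : d *: (h *m u) = d *: (h *m w) -> u = w.
  move=> /(scalerI d0) /(congr1 (mulmx (invmx h))).
  by rewrite !mulmxA mulVmx // !mul1mx.
have Uout j : exists2 w : 'cV[L]_2,
    (forall i, vge 0 (w i ord0)) & U *m delta_mx j ord0 = w.
  have : [set A *m u | u in M] (A *m (h *m delta_mx j ord0)).
    by exists (h *m delta_mx j ord0) => //; rewrite eM; exists (delta_mx j ord0).
  rewrite eA hU eM => -[_ [w iw <-]] /h_inj e.
  by exists w.
have Uin j : exists w : 'cV[L]_2,
    (forall i, vge 0 (w i ord0)) /\ U *m w = delta_mx j ord0.
  have : [set d *: u | u in M] (d *: (h *m delta_mx j ord0)).
    by exists (h *m delta_mx j ord0) => //; rewrite eM; exists (delta_mx j ord0).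
  rewrite -eA eM => -[_ [w iw <-]]; rewrite hU => /h_inj e.
  by exists w.
have [w hw] := choice Uin.
exists h, U, (\matrix_(i, j) w j i ord0), d; split=> //.
- move=> i j; have [u iu e] := Uout j.
  by have := iu i; rewrite -e -colE mxE.
- by move=> i j; rewrite mxE; apply: (hw j).1.
apply/matrixP => i j; have /matrixP/(_ i ord0) := (hw j).2.
rewrite !mxE andbT => <-; apply: eq_bigr => k _; congr (_ * _).
by rewrite mxE.
Qed.
End Valuation.

(** * Growth of powers at one place *)

Section LocalGrowth.
Variables (F : finFieldType) (K : ratfun F) (c x : F) (T : splitting K c x).
Local Notation A := (quat c%:P 'X).
Local Notation emb P := (qmap (cemb T) (qK K P)).
Local Notation cge := (coord_ge (@cval _ _ _ T)).
Implicit Types (P Q : A).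

Lemma mupX (p : {poly F}) n : p != 0 -> mup x (p ^+ n) = (n * mup x p)%N.
Proof.
move=> p0; elim: n => [|n IH]; last by rewrite exprS mupM ?expf_neq0 // IH.
by rewrite expr0 mupNroot // root1.
Qed.

Lemma val_ge_dvdp n (m : nat) (p : {poly F}) :
  val_ge (@cval _ _ _ T) n (cemb T (fr K p)) -> m%:Z <= n -> ('X - x%:P) ^+ m %| p.
Proof.
have [->|p0] := eqVneq p 0; first by rewrite dvdp0.
case=> [/eqP|].
  by rewrite fmorph_eq0 -(rmorph0 (fr K)) (inj_eq (@fr_inj _ K)) (negbTE p0).
by rewrite cval_fr // -mup_geq // => /[swap] /le_trans /[apply].
Qed.

Definition qdvd (r : {poly F}) P := [&& r %| q1 P, r %| qz P, r %| qf P & r %| qfz P].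

Lemma qdvdP r P : reflect (exists Q, P = r *: Q) (qdvd r P).
Proof.
apply: (iffP and4P) => [[]|[Q ->]]; last by split; apply: dvdp_mulIl.
case: P => /= p1 p2 p3 p4 /dvdpP [s1 ->] /dvdpP [s2 ->] /dvdpP [s3 ->] /dvdpP [s4 ->].
by exists (Quat s1 s2 s3 s4); congr Quat; rewrite mulrC.
Qed.

Lemma coord_ge_qdvd n (m : nat) P :
  cge n (emb P) -> m%:Z <= n -> qdvd (('X - x%:P) ^+ m) P.
Proof. by case=> ? ? ? ? mn; apply/and4P; split; apply: val_ge_dvdp mn. Qed.

Lemma emb_nrd P : emb P * emb (qconj P) = (cemb T (fr K (nrd P)))%:A.
Proof.
rewrite /qK !qmap_conj qmulJ.
by congr (_ *: _); rewrite nrd_qmap; congr (cemb T _); rewrite nrd_qmap.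
Qed.

Lemma growth_le_mup P (k : int) (B : nat) : nrd P != 0 ->
  (forall n : nat, cge (n%:Z * k - B%:Z) (emb (P ^+ n))) -> 2 * k <= (mup x (nrd P))%:Z.
Proof.
move=> P0 growth; rewrite leNgt; apply/negP => lt.
(* Divisibility of the norm gives [2 (n k - B) <= n mup], and [mup <= 2 k - 1] would then force
   [n <= 2 B]. *)
pose n := (2 * B).+1; pose m := absz (n%:Z * k - B%:Z)%R.
have em : m%:Z = n%:Z * k - B%:Z by rewrite /m /n; nia.
have /qdvdP [Y eY] : qdvd (('X - x%:P) ^+ m) (P ^+ n).
  by apply: coord_ge_qdvd (growth n) _; rewrite em.
have : ('X - x%:P) ^+ (2 * m) %| nrd P ^+ n.
  by rewrite -nrdX eY nrdZ -exprM mulnC dvdp_mulIl.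
rewrite -mup_geq ?expf_neq0 // mupX //; rewrite /n in em *; nia.
Qed.

(** If [P] acts as [d] times an integral invertible matrix, its conjugate acts as [N / d] times the
    inverse matrix. The growth bounds for both give [2 v(d) <= v(N)] and [2 (v(N) - v(d)) <= v(N)],
    hence [v(N) = 2 v(d)]. *)
Lemma stable_growth P X : nrd P != 0 -> vertex (@cval _ _ _ T) X ->
  mact (sphi T (emb P)) X = X ->
  exists kB : nat * nat, mup x (nrd P) = (2 * kB.1)%N /\
    forall n, qdvd (('X - x%:P) ^+ (n * kB.1)) (('X - x%:P) ^+ kB.2 *: P ^+ n).
Proof.
move=> P0 [M lM ->] /(lattice_stab (@cvalM _ _ _ T) lM).
move=> [h [U [U' [d [uh iU iU' UU' [d0 eP]]]]]].
set N := cemb T (fr K (nrd P)).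
have N0 : N != 0.
  by rewrite fmorph_eq0 -(rmorph0 (fr K)) (inj_eq (@fr_inj _ K)).
have vN : cval N = (mup x (nrd P))%:Z by rewrite cval_fr.
have UU : U' *m U = 1%:M by apply: mulmx1C.
have eC : sphi T (emb (qconj P)) = (N / d) *: (h *m U' *m invmx h).
  have : sphi T (emb P) *m sphi T (emb (qconj P)) = N%:M.
    transitivity (sphi T (emb P * emb (qconj P))); first by apply/esym/rmorphM.
    rewrite emb_nrd; transitivity (N *: sphi T 1); first exact: linearZ.
    by rewrite (rmorph1 (sphi T)) scalemx1.
  (* Multiplication by the inverse of the matrix of [P] isolates that of the conjugate. *)
  move=> /(congr1 (mulmx (d^-1 *: (h *m U' *m invmx h)))).
  rewrite mulmxA eP -scalemxAl -scalemxAr scalerA mulVf // scale1r.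
  rewrite -!mulmxA (mulmxA (invmx h) h) mulVmx // mul1mx (mulmxA U' U) UU.
  rewrite mul1mx mulmxA mulmxV // mul1mx => ->.
  by rewrite mul_mx_scalar scalerA !mulmxA.
have embX Q n : emb (Q ^+ n) = emb Q ^+ n by rewrite /qK !qmapX.
have Nd0 : N / d != 0 by rewrite mulf_neq0 ?invr_neq0.
have [B hB] := coord_ge_exp (@cvalM _ _ _ T) (@cvalD _ _ _ T) (sphi_bij T) uh iU d0 eP.
have [B' hB'] :=
  coord_ge_exp (@cvalM _ _ _ T) (@cvalD _ _ _ T) (sphi_bij T) uh iU' Nd0 eC.
have le1 : 2 * cval d <= (mup x (nrd P))%:Z.
  by apply: (@growth_le_mup _ _ B) => // n; rewrite embX.
have le2 : 2 * cval (N / d) <= (mup x (nrd P))%:Z.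
  rewrite -nrd_conj; apply: (@growth_le_mup _ _ B'); rewrite ?nrd_conj // => n.
  by rewrite embX.
have vNd : cval (N / d) + cval d = cval N by rewrite -cvalM // divfK.
exists (`|cval d|%N, B) => /=; split; first by lia.
move=> n; set k := `|cval d|%N; have ek : k%:Z = cval d by rewrite /k; lia.
(* For small [n] the factor of exponent [B] alone is divisible enough. *)
have [le|lt] := leqP (n * k) B.
  apply/qdvdP; exists (('X - x%:P) ^+ (B - n * k) *: P ^+ n).
  by rewrite scalerA -exprD subnKC.
have /qdvdP [Y eY] : qdvd (('X - x%:P) ^+ (n * k - B)) (P ^+ n).
  by apply: (@coord_ge_qdvd (n%:Z * cval d - B%:Z)); rewrite ?embX // -ek; nia.
apply/qdvdP; exists Y; rewrite eY scalerA -exprD; congr (_ ^+ _ *: _).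
by rewrite subnKC // ltnW.
Qed.
End LocalGrowth.

(** * Finitely many normalised powers *)

Section Pigeonhole.
Variables (F : finFieldType) (c : F) (S0 : {set F}).
Hypothesis c_nonsquare : forall x : F, x ^+ 2 != c.
Local Notation A := (quat c%:P 'X).
Implicit Types (e : F -> nat) (P Q : A).

Definition lprod e : {poly F} := \prod_(x in S0) ('X - x%:P) ^+ e x.

Lemma lprod_neq0 e : lprod e != 0.
Proof. by apply/prodf_neq0 => x _; rewrite expf_neq0 ?polyXsubC_eq0. Qed.

Lemma lprodD e e' : lprod (fun x => e x + e' x)%N = lprod e * lprod e'.
Proof. by rewrite -big_split; apply: eq_bigr => x _; rewrite exprD. Qed.

Lemma lprodX e n : lprod e ^+ n = lprod (fun x => n * e x)%N.
Proof. by rewrite -prodrXl; apply: eq_bigr => x _; rewrite -exprM mulnC. Qed.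

Lemma mup_lprod C e y : C != 0 -> y \in S0 -> mup y (C *: lprod e) = e y.
Proof.
move=> C0 yS; rewrite -mul_polyC mupMr ?rootC // /lprod (bigD1 y) //=.
rewrite mupMl ?mup_XsubCX ?eqxx //.
rewrite rootE horner_prod; apply/prodf_neq0 => x /andP[_ xy].
by rewrite horner_exp expf_neq0 // hornerXsubC subr_eq0 eq_sym.
Qed.

Lemma lprod_dvd e p : (forall x, x \in S0 -> ('X - x%:P) ^+ e x %| p) -> lprod e %| p.
Proof.
rewrite /lprod -big_enum; have := enum_uniq S0.
have : {subset enum S0 <= S0} by move=> x; rewrite mem_enum.
elim: (enum S0) => [|y s IH] sS /= uniq_s dv; first by rewrite big_nil dvd1p.
move: uniq_s => /andP[ys us].
rewrite big_cons Gauss_dvdp; last first.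
  rewrite big_seq; apply: (big_ind (coprimep _)) => [||x xs].
  - exact: coprimep1.
  - by move=> ? ? ? ?; rewrite coprimepMr; apply/andP.
  rewrite coprimep_expl // coprimep_expr // coprimep_XsubC root_XsubC.
  by apply: contraNneq ys => <-.
rewrite dv ?sS ?mem_head //; apply: IH => // x xs.
by apply: sS; rewrite inE xs orbT.
Qed.

Lemma lprod_qdvd e P :
  (forall x, x \in S0 -> qdvd (('X - x%:P) ^+ e x) P) -> qdvd (lprod e) P.
Proof.
by move=> h; apply/and4P; split; apply: lprod_dvd => x /h /and4P [].
Qed.

(* The hypotheses say that [Q ^+ n = R ^+ n *: (Y / T)] for fixed polynomials R, T;
   the norms of the quaternions Y have bounded degree, so that two of them agree. *)
Lemma scalar_power Q (k B : F -> nat) C : C != 0 ->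
  nrd Q = C *: lprod (fun x => 2 * k x)%N ->
  (forall x, x \in S0 -> forall n,
     qdvd (('X - x%:P) ^+ (n * k x)) (('X - x%:P) ^+ B x *: Q ^+ n)) ->
  exists d r, (0 < d)%N /\ Q ^+ d = r%:A.
Proof.
move=> C0 nQ growth; pose R := lprod k; pose T := lprod B.
have R0 : R != 0 := lprod_neq0 k; have T0 : T != 0 := lprod_neq0 B.
have nQR : nrd Q = C *: R ^+ 2 by rewrite nQ lprodX.
have /choice [Y eY] n : exists Y, T *: Q ^+ n = R ^+ n *: Y.
  apply/qdvdP; rewrite lprodX; apply: lprod_qdvd => x xS.
  have /qdvdP [Y eY] := growth x xS n; apply/qdvdP.
  (* The local statement only supplies the factor of [T] at [x]; the other factors are multiplied
     in. *)
  exists ((\prod_(y in S0 | y != x) ('X - y%:P) ^+ B y) *: Y).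
  by rewrite scalerA mulrC -scalerA -eY scalerA mulrC /T /lprod (bigD1 x).
(* The norm depends on [n] only through a nonzero constant, so its degree is fixed. *)
have nY n : nrd (Y n) = C ^+ n *: T ^+ 2.
  have : R ^+ n ^+ 2 * nrd (Y n) = R ^+ n ^+ 2 * (C ^+ n *: T ^+ 2).
    rewrite -nrdZ -eY nrdZ nrdX nQR exprZn -!exprM mulnC -scalerAr mulrC.
    by rewrite scalerAr.
  by apply: mulfI; rewrite !expf_neq0.
pose b := size (T ^+ 2).
have sY n : (size (nrd (Y n)) <= b)%N by rewrite nY size_scale ?expf_neq0.
(* By [size_nrd_ge] all four coordinates have size at most [b], so nothing is lost by keeping [b]
   coefficients. *)
pose enc n := (poly_rV (q1 (Y n)) : 'rV[F]_b, poly_rV (qz (Y n)) : 'rV[F]_b,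
  poly_rV (qf (Y n)) : 'rV[F]_b, poly_rV (qfz (Y n)) : 'rV[F]_b).
have enc_inj m n : enc m = enc n -> Y m = Y n.
  have small i : [/\ size (q1 (Y i)) <= b, size (qz (Y i)) <= b,
      size (qf (Y i)) <= b & size (qfz (Y i)) <= b]%N.
    have := leq_trans (size_nrd_ge c_nonsquare (Y i)) (sY i).
    by rewrite !geq_max => /andP[/andP[-> ->] /andP[-> ->]].
  have := small m; have := small n; rewrite /enc.
  case: (Y m) (Y n) => [m1 m2 m3 m4] [n1 n2 n3 n4] /= [? ? ? ?] [? ? ? ?].
  have poly_eq (p q : {poly F}) : (size p <= b)%N -> (size q <= b)%N ->
      poly_rV p = poly_rV q :> 'rV[F]_b -> p = q.
    by move=> sp sq /(congr1 rVpoly); rewrite !poly_rV_K.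
  by case=> /poly_eq-> // /poly_eq-> // /poly_eq-> // /poly_eq-> //.
have [m [n [mn eYmn]]] : exists m n, (m < n)%N /\ Y m = Y n.
  pose f (i : 'I_(#|{: 'rV[F]_b * 'rV[F]_b * 'rV[F]_b * 'rV[F]_b}|.+1)) := enc i.
  have /injectivePn [i [j ij /enc_inj e]] : ~~ injectiveb f.
    by apply/injectiveP => /leq_card; rewrite card_ord ltnn.
  have [lt|lt|/val_inj eij] := ltngtP i j; [by exists i, j | by exists j, i |].
  by rewrite eij eqxx in ij.
exists (n - m)%N, (R ^+ (n - m)); split; first by rewrite subn_gt0.
(* After cancelling [Q ^+ m] and [T], what remains is [R^n Y = R^(n-m) R^m Y]. *)
apply/eqP; rewrite -subr_eq0; apply/eqP; apply: (@quat_mul_eq0r _ _ _ (Q ^+ m)).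
  by rewrite nrdX nQR expf_neq0 // scaler_eq0 negb_or C0 expf_neq0.
apply: (quat_scaler_eq0 T0).
rewrite mulrBr -exprD subnKC ?(ltnW mn) // scalerBr -scalerAr mulr1 scalerA.
by rewrite mulrC -scalerA !eY eYmn scalerA -exprD subnK ?subrr // ltnW.
Qed.
End Pigeonhole.

(** * Freeness on the cells *)

Section FreeAction.
Variables (F : finFieldType) (K : ratfun F) (S : rplaces F) (c : F).
Hypothesis c_nonsquare : forall x : F, x ^+ 2 != c.

(** A letter of norm n contributes [1 - n t = - n (t - 1/n)], and 1/n lies in S_0; thus [e] counts
    the letters at each place. *)
Lemma nrd_polyP (s : seq (letter S c)) : exists C e,
  C != 0 /\ nrd (polyP s) = C *: lprod (finplaces S) e.
Proof.
elim: s => [|a s [C [e [C0 IH]]]].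
  exists 1, (fun=> 0%N); rewrite oner_neq0 /polyP /Pq big_nil nrd1 /lprod.
  by rewrite big1 ?scale1r.
have n0 := normE_neq0 a; set n := normE c (val a) in n0.
exists (- n * C), (fun x => (x == n^-1) + e x)%N.
split; first by rewrite mulf_neq0 ?oppr_eq0.
rewrite /polyP /= Pq_cons nrdM -/(polyP s) IH lprodD nrd_op -/n.
have -> : lprod (finplaces S) (fun x => (x == n^-1)) = 'X - n^-1%:P.
  rewrite /lprod (bigD1 n^-1) /= ?(valP a) // eqxx.
  rewrite big1 ?mulr1 // => x /andP[_ /negbTE ->].
  by rewrite expr0.
rewrite -scalerAr [- n * C]mulrC -scalerA; congr (_ *: _); rewrite scalerAl; congr (_ * _).
by rewrite scaleNr scalerBr opprB -(mul_polyC n n^-1%:P) -polyCM divff.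
Qed.

(** Only an inversion of an edge moves both of its ends, and the square of an inversion fixes
    them. *)
Lemma cell_square_fixed (L : fieldType) (v : L -> int)
    (f : set (set 'cV[L]_2) -> set (set 'cV[L]_2)) C :
  cell v C -> [set f X | X in C] = C -> exists2 X, vertex v X & f (f X) = X.
Proof.
case=> [[X vX ->]|[X [Y [[vX vY _] ->]]]] fC.
  have /= e : [set X] (f X) by rewrite -fC; exists X.
  by exists X; rewrite ?e.
have fX : [set X; Y] (f X) by rewrite -fC; exists X => //; left.
have fY : [set X; Y] (f Y) by rewrite -fC; exists Y => //; right.
case: fX => /= fX; first by exists X; rewrite ?fX.
case: fY => /= fY; last by exists Y; rewrite ?fY.
by exists X; rewrite ?fX ?fY.
Qed.

Lemma mact_mul (L : fieldType) (g h : 'M[L]_2) X : mact g (mact h X) = mact (g *m h) X.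
Proof.
rewrite /mact image_comp; congr image; apply/funext => M /=.
by rewrite image_comp; congr image; apply/funext => u /=; rewrite mulmxA.
Qed.

(** The chosen representative of [g] differs from the image of [P] by a scalar [u]; homothety
    classes absorb [u^2]. *)
Lemma lam_act_square x (T : splitting K c x) (g : Lambda K S c) P X : represents g P ->
  vertex (@cval _ _ _ T) X -> lam_act (T := T) g (lam_act (T := T) g X) = X ->
  mact (sphi T (qmap (cemb T) (qK K (P ^+ 2)))) X = X.
Proof.
case=> w -> ew [M _ ->]; rewrite /lam_act; have [u [u0 _ _] ->] := lam_reprP w.
rewrite mact_mul => e; rewrite -[RHS]e ew.
set y := qmap (cemb T) (qK K P); pose d := cemb T u.
have d0 : d ^+ 2 != 0 by rewrite expf_neq0 // fmorph_eq0.
rewrite -(macts _ _ d0); congr (mact _ _).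
have -> : qmap (cemb T) (u *: qK K P) = d *: y by rewrite qmapZ.
transitivity (sphi T ((d *: y) * (d *: y))); last exact: rmorphM.
rewrite -scalerAl -scalerAr scalerA -expr2 /qK !qmapX -expr2.
by apply/esym/linearZ.
Qed.

Lemma Gamma_free (T : forall x : {x : F | x \in finplaces S}, splitting K c (val x))
    (g : Lambda K S c) (C : forall x, set (set (set 'cV[T x]_2))) :
  Gamma K S c g -> cube C -> cube_act g C = C -> g = 1%g.
Proof.
move=> Gg cC gC; have [s gs] := Gamma_represents c_nonsquare Gg.
have P0 := polyP_unit s; set P := polyP s in gs P0.
have [D [e [D0 nP]]] := nrd_polyP s.
have nP2 : nrd (P ^+ 2) = D ^+ 2 *: lprod (finplaces S) (fun x => 2 * e x)%N.
  by rewrite nrdX nP exprZn lprodX.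
(* Membership in S_0 is put under the existential, with 0 as default outside, so that choice yields
   a function on all of [F]. *)
have growth x : exists B : nat, x \in finplaces S -> forall n,
    qdvd (('X - x%:P) ^+ (n * e x)) (('X - x%:P) ^+ B *: (P ^+ 2) ^+ n).
  have [xS|] := boolP (x \in finplaces S); last by exists 0%N.
  pose i : {x : F | x \in finplaces S} := exist _ x xS.
  have gCi : [set lam_act (T := T i) g X | X in C i] = C i.
    by rewrite -[RHS](congr1 (fun C => C i) gC).
  have [X vX fX] := cell_square_fixed (cC i) gCi.
  have P20 : nrd (P ^+ 2) != 0 by rewrite nrdX expf_neq0.
  (* The norm of [P ^+ 2] has multiplicity [2 (e x)] at [x], which identifies [k] with [e x]. *)
  have [[k B] /= [ek h]] := stable_growth P20 vX (lam_act_square gs vX fX).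
  exists B => _ n; move: ek; rewrite nP2 mup_lprod ?expf_neq0 //= => /eqP.
  by rewrite eqn_mul2l /= => /eqP ->; apply: h.
have [B hB] := choice growth.
have D20 : D ^+ 2 != 0 by rewrite expf_neq0.
have [d [r [d0 ePd]]] := scalar_power c_nonsquare D20 nP2 hB.
apply: (Gamma_torsion_free c_nonsquare Gg (n := (2 * d)%N)); first by rewrite muln_gt0.
apply/(represents_eq1 (representsX _ gs)).
by rewrite exprM ePd !quat_scalarE.
Qed.
End FreeAction.

Theorem theorem2p27 (F : finFieldType) (q_odd : odd #|F|)
    (c : F) (c_nonsquare : forall x : F, x ^+ 2 != c) (S : rplaces F) :
  has_presentation (Gamma (Fqt F) S c) (fun x : set_type (gens (Fqt F) S c) => val x)
    (square_rel (Fqt F) S c) /\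
  (forall (T : forall x : {x : F | x \in finplaces S}, splitting (Fqt F) c (val x))
      (g : Lambda (Fqt F) S c) (C : forall x, set (set (set 'cV[T x]_2))),
    Gamma (Fqt F) S c g -> cube C -> cube_act g C = C -> g = 1%g) /\
  (forall (g : Lambda (Fqt F) S c) (n : nat),
    Gamma (Fqt F) S c g -> (0 < n)%N -> (g ^+ n)%g = 1%g -> g = 1%g).
Proof.
split; first exact: Gamma_presentation.
by split=> [T g C|g n]; [apply: Gamma_free | apply: Gamma_torsion_free].
Qed.
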